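(* Let $\Psi:(M,\varphi,\zeta,\eta,g_M)\to(N,g_N)$ be a semi-invariant conformal $\zeta^\perp$-Riemannian submersion with dilation $\lambda$ from a Sasakian manifold onto a Riemannian manifold, with associated decompositions $\ker\Psi_*=D_1\oplus D_2$, $(\ker\Psi_* )^\perp=\varphi D_2\oplus\mu$. Then $D_2$ defines a totally geodesic foliation on $M$ if and only if, for all $W,\xi\in\Gamma(D_2)$, $U\in\Gamma(D_1)$ and $Z\in\Gamma((\ker\Psi_* )^\perp)$, $$(\nabla\Psi_* )(W,\varphi U)\in\Gamma(\Psi_*\mu)$$ and $$\frac1{\lambda^2}g_N\big(\nabla^\Psi_{\varphi\xi}\Psi_*\varphi W,\Psi_*\varphi\beta Z\big)=g_M(\varphi\xi,T_W\alpha Z)-g_M(W,\xi)\,g_M(\mathcal H\,\mathrm{grad}\ln\lambda,\varphi\beta Z)+\eta(\beta Z)g_M(W,\xi).$$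
   Context: An almost contact metric manifold $(M,\varphi,\zeta,\eta,g_M)$ is an odd-dimensional manifold with a $(1,1)$-tensor field $\varphi$, a vector field $\zeta$, a $1$-form $\eta$ and a Riemannian metric $g_M$ such that $\varphi^2P=-P+\eta(P)\zeta$, $\varphi\zeta=0$, $\eta\circ\varphi=0$, $\eta(\zeta)=1$, $g_M(P,\zeta)=\eta(P)$, $g_M(\varphi P,\varphi Q)=g_M(P,Q)-\eta(P)\eta(Q)$ and $g_M(\varphi P,Q)=-g_M(P,\varphi Q)$. With $\nabla$ the Levi-Civita connection of $g_M$, it is Sasakian if $(\nabla_P\varphi)Q=g_M(P,Q)\zeta-\eta(Q)P$ and $\nabla_P\zeta=-\varphi P$ for all vector fields $P,Q$. A horizontally conformal submersion $\Psi:(M,g_M)\to(N,g_N)$, $\dim M>\dim N$, is a map of $M$ onto $N$ of maximal rank such that $g_N(\Psi_*U,\Psi_*V)=\lambda^2g_M(U,V)$ for all $U,V\in(\ker\Psi_* )^\perp$, where $\lambda$ is a positive function on $M$, called the dilation. Vectors in $\ker\Psi_*$ are vertical, those in $(\ker\Psi_* )^\perp$ horizontal; $\mathcal V$ and $\mathcal H$ denote the orthogonal projections of $TM$ onto $\ker\Psi_*$ and $(\ker\Psi_* )^\perp$. A semi-invariant conformal $\zeta^\perp$-Riemannian submersion from an almost contact metric manifold onto a Riemannian manifold is a horizontally conformal submersion $\Psi$ with dilation $\lambda$ such that $\zeta$ is orthogonal to $\ker\Psi_*$ and there is a distribution $D_1\subseteq\ker\Psi_*$ with $\ker\Psi_*=D_1\oplus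 D_2$, $\varphi(D_1)=D_1$, $\varphi(D_2)\subseteq(\ker\Psi_* )^\perp$, where $D_2$ is the orthogonal complement of $D_1$ in $\ker\Psi_*$. One writes $(\ker\Psi_* )^\perp=\varphi D_2\oplus\mu$, where $\mu$ is the orthogonal complement of $\varphi D_2$ in $(\ker\Psi_* )^\perp$; $\mu$ is $\varphi$-invariant and $\zeta\in\mu$. For horizontal $P$ write $\varphi P=\alpha P+\beta P$ with $\alpha P\in\Gamma(D_2)$, $\beta P\in\Gamma(\mu)$. O'Neill's tensor $T$ is $T_EF=\mathcal H\nabla_{\mathcal VE}\mathcal VF+\mathcal V\nabla_{\mathcal VE}\mathcal HF$. The second fundamental form of $\Psi$ is $(\nabla\Psi_* )(E,F)=\nabla^\Psi_E\Psi_*F-\Psi_*(\nabla_EF)$, where $\nabla^\Psi$ is the pullback to $\Psi^{-1}TN$ of the Levi-Civita connection of $N$. $\Gamma(\Psi_*\mu)$ denotes sections of $\Psi^{-1}TN$ with values in $\Psi_*(\mu)$. A distribution $D$ defines a totally geodesic foliation on $M$ iff $\nabla_XY\in\Gamma(D)$ for all $X,Y\in\Gamma(D)$. *)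

(* Defs.v *)
From HB Require Import structures.
From mathcomp Require Import all_boot all_order all_algebra.
From mathcomp Require Import all_classical all_reals all_analysis.

Set Implicit Arguments.
Unset Strict Implicit.
Unset Printing Implicit Defensive.

Import Order.TTheory GRing.Theory Num.Theory.
Import numFieldNormedType.Exports.

Local Open Scope classical_set_scope.
Local Open Scope ring_scope.

(* Vectors are row vectors, so linear maps act by
   multiplication on the right and subspaces are row spaces (scope %MS). *)

(* f is of class C^k on U; only meant for U open. *)
Fixpoint Ck (R : realType) (V W : normedModType R) (k : nat) (U : set V)
    (f : V -> W) : Prop :=
  match k with
  | 0 => forall x, U x -> {for x, continuous f}
  | k'.+1 => (forall x, U x -> differentiable f x) /\
             (forall v : V, Ck k' U (fun x => 'd f x v))
  end.

Definition Cinfty (R : realType) (V W : normedModType R) (U : set V)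
    (f : V -> W) : Prop := forall k, Ck k U f.

(* cfun and cinv are total; their values outside cdom and outside the open set
   cfun @` cdom are irrelevant. *)
Record chart (R : realType) (n : nat) (T : topologicalType) := Chart {
  cdom : set T;
  cfun :> T -> 'rV[R]_n;
  cinv : 'rV[R]_n -> T;
  cdom_open : open cdom;
  cimg_open : open (cfun @` cdom);
  cfunK : forall p, cdom p -> cinv (cfun p) = p;
  cfun_continuous : forall p, cdom p -> {for p, continuous cfun};
  cinv_continuous :
    forall x, (cfun @` cdom) x -> {for x, continuous cinv} }.

(* The atlas need not be maximal. chart_at chooses a chart around each point;
   its only role is to identify the tangent space at p with R^n. *)
Record manifold (R : realType) (n : nat) := Manifold {
  carrier :> topologicalType;
  atlas : set (chart R n carrier);
  chart_at : carrier -> chart R n carrier;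
  manifold_hausdorff : hausdorff_space carrier;
  manifold_second_countable : @second_countable carrier;
  chart_at_atlas : forall p, atlas (chart_at p);
  chart_at_dom : forall p, cdom (chart_at p) p;
  atlas_compatible : forall c d, atlas c -> atlas d ->
    Cinfty (c @` (cdom c `&` cdom d)) (d \o cinv c) }.

(* A is meant to be open. *)
Definition smooth_on (R : realType) (n : nat) (M : manifold R n)
    (W : normedModType R) (A : set M) (h : M -> W) : Prop :=
  forall c, atlas c -> Cinfty (c @` (cdom c `&` A)) (h \o cinv c).

Definition smooth_fun (R : realType) (n : nat) (M : manifold R n)
    (f : M -> R) : Prop := smooth_on setT (f : M -> R^o).

(* Tangent vectors at p are represented by their components in the chart
   chart_at p. tder h p v is the derivative of h at p along v. *)
Definition tder (R : realType) (n : nat) (M : manifold R n)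
    (W : normedModType R) (h : M -> W) (p : M) (v : 'rV[R]_n) : W :=
  'd (h \o cinv (chart_at p)) (chart_at p p) v.

Definition dfun (R : realType) (n : nat) (M : manifold R n)
    (f : M -> R) (p : M) (v : 'rV[R]_n) : R := tder (f : M -> R^o) p v.

Definition smooth_map (R : realType) (m n : nat) (M : manifold R m)
    (N : manifold R n) (f : M -> N) : Prop :=
  continuous f /\
  forall c, atlas c -> smooth_on (f @^-1` cdom c) (c \o f).

(* The matrix of f_* at p: v is sent to v *m tmap f p. *)
Definition tmap (R : realType) (m n : nat) (M : manifold R m)
    (N : manifold R n) (f : M -> N) (p : M) : 'M[R]_(m, n) :=
  'J (chart_at (f p) \o f \o cinv (chart_at p)) (chart_at p p).

(* s p is a tangent vector of N at f p; smoothness is that of the components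
   of s in every chart of N. *)
Definition smooth_section_on (R : realType) (m n : nat) (M : manifold R m)
    (N : manifold R n) (f : M -> N) (A : set M) (s : M -> 'rV[R]_n) : Prop :=
  forall c, atlas c ->
    smooth_on (A `&` f @^-1` cdom c) (fun p => tder c (f p) (s p)).

Definition smooth_section (R : realType) (m n : nat) (M : manifold R m)
    (N : manifold R n) (f : M -> N) (s : M -> 'rV[R]_n) : Prop :=
  smooth_section_on f setT s.

Definition smooth_vfield_on (R : realType) (n : nat) (M : manifold R n)
    (A : set M) (X : M -> 'rV[R]_n) : Prop := smooth_section_on idfun A X.

Definition smooth_vfield (R : realType) (n : nat) (M : manifold R n)
    (X : M -> 'rV[R]_n) : Prop := smooth_vfield_on setT X.

Definition tapp (R : realType) (m k : nat) (M : Type) (t : M -> 'M[R]_(m, k))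
    (X : M -> 'rV[R]_m) : M -> 'rV[R]_k := fun p => X p *m t p.

Definition smooth_endo (R : realType) (n : nat) (M : manifold R n)
    (t : M -> 'M[R]_n) : Prop :=
  forall (A : set M) X, open A ->
    smooth_vfield_on A X -> smooth_vfield_on A (tapp t X).

Definition ev (R : realType) (n : nat) (a : 'cV[R]_n) (v : 'rV[R]_n) : R :=
  (v *m a) 0 0.

Definition smooth_form (R : realType) (n : nat) (M : manifold R n)
    (a : M -> 'cV[R]_n) : Prop :=
  forall (A : set M) X, open A -> smooth_vfield_on A X ->
    smooth_on A ((fun p => ev (a p) (X p)) : M -> R^o).

Definition ip (R : realType) (n : nat) (G : 'M[R]_n) (u v : 'rV[R]_n) : R :=
  (u *m G *m v^T) 0 0.

Definition riemannian_metric (R : realType) (n : nat) (M : manifold R n)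
    (g : M -> 'M[R]_n) : Prop :=
  [/\ forall p u v, ip (g p) u v = ip (g p) v u,
      forall p u, u != 0 -> 0 < ip (g p) u u
    & forall (A : set M) X Y, open A ->
        smooth_vfield_on A X -> smooth_vfield_on A Y ->
        smooth_on A ((fun p => ip (g p) (X p) (Y p)) : M -> R^o)].

Definition grad (R : realType) (n : nat) (M : manifold R n)
    (g : M -> 'M[R]_n) (f : M -> R) : M -> 'rV[R]_n :=
  fun p => (\row_i dfun f p (delta_mx 0 i)) *m invmx (g p).

(* D is a connection on the pullback of TN by f; for f the identity, an affine
   connection. *)
Definition connection (R : realType) (m n : nat) (M : manifold R m)
    (N : manifold R n) (f : M -> N)
    (D : (M -> 'rV[R]_m) -> (M -> 'rV[R]_n) -> M -> 'rV[R]_n) : Prop :=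
  [/\ forall X s, smooth_vfield X -> smooth_section f s ->
        smooth_section f (D X s),
      forall X Y s p, smooth_vfield X -> smooth_vfield Y ->
        smooth_section f s ->
        D (fun q => X q + Y q) s p = D X s p + D Y s p,
      forall h X s p, smooth_fun h -> smooth_vfield X ->
        smooth_section f s -> D (fun q => h q *: X q) s p = h p *: D X s p,
      forall X s t p, smooth_vfield X -> smooth_section f s ->
        smooth_section f t ->
        D X (fun q => s q + t q) p = D X s p + D X t p
    & forall h X s p, smooth_fun h -> smooth_vfield X ->
        smooth_section f s ->
        D X (fun q => h q *: s q) p
        = h p *: D X s p + dfun h p (X p) *: s p].

Definition levi_civita (R : realType) (n : nat) (M : manifold R n)
    (g : M -> 'M[R]_n)
    (D : (M -> 'rV[R]_n) -> (M -> 'rV[R]_n) -> M -> 'rV[R]_n) : Prop :=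
  [/\ connection (idfun : M -> M) D,
      (* torsion-free: D X Y - D Y X acts on functions as [X, Y] *)
      forall X Y h p, smooth_vfield X -> smooth_vfield Y -> smooth_fun h ->
        dfun h p (D X Y p - D Y X p)
        = dfun (fun q => dfun h q (Y q)) p (X p)
          - dfun (fun q => dfun h q (X q)) p (Y p)
    & forall X Y Z p, smooth_vfield X -> smooth_vfield Y -> smooth_vfield Z ->
        dfun (fun q => ip (g q) (Y q) (Z q)) p (X p)
        = ip (g p) (D X Y p) (Z p) + ip (g p) (Y p) (D X Z p)].

(* Df is the pullback by f of the affine connection D of N: the value of Df on
   the section Y \o f, in a direction X p with f_*(X p) = V (f p), is
   (D V Y) (f p). *)
Definition pullback_connection (R : realType) (m n : nat) (M : manifold R m)
    (N : manifold R n) (f : M -> N)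
    (D : (N -> 'rV[R]_n) -> (N -> 'rV[R]_n) -> N -> 'rV[R]_n)
    (Df : (M -> 'rV[R]_m) -> (M -> 'rV[R]_n) -> M -> 'rV[R]_n) : Prop :=
  connection f Df /\
  forall X V Y p, smooth_vfield X -> smooth_vfield V -> smooth_vfield Y ->
    X p *m tmap f p = V (f p) -> Df X (Y \o f) p = D V Y (f p).

Definition smooth_distribution (R : realType) (n : nat) (M : manifold R n)
    (D : M -> 'M[R]_n) : Prop :=
  exists r : nat, forall p, exists (A : set M) (X : 'I_r -> M -> 'rV[R]_n),
    [/\ open A, A p, forall i, smooth_vfield_on A (X i)
      & forall q, A q -> row_free (\matrix_i X i q) /\
                         (\matrix_i X i q :=: D q)%MS].

Definition Gamma (R : realType) (n : nat) (M : manifold R n)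
    (D : M -> 'M[R]_n) (X : M -> 'rV[R]_n) : Prop :=
  smooth_vfield X /\ forall p, (X p <= D p)%MS.

Definition Gamma_along (R : realType) (m n k : nat) (M : manifold R m)
    (N : manifold R n) (f : M -> N) (D : M -> 'M[R]_(k, n))
    (s : M -> 'rV[R]_n) : Prop :=
  smooth_section f s /\ forall p, (s p <= D p)%MS.

Definition totally_geodesic_foliation (R : realType) (n : nat)
    (M : manifold R n)
    (nabla : (M -> 'rV[R]_n) -> (M -> 'rV[R]_n) -> M -> 'rV[R]_n)
    (D : M -> 'M[R]_n) : Prop :=
  forall X Y, Gamma D X -> Gamma D Y -> Gamma D (nabla X Y).

(* The orthogonal complement: v *m (G *m D^T) = 0 says that v is G-orthogonal
   to the rows of D. *)
Definition orth (R : realType) (k n : nat) (G : 'M[R]_n) (D : 'M[R]_(k, n))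
    : 'M[R]_n := kermx (G *m D^T).

Definition oproj (R : realType) (n : nat) (G D : 'M[R]_n) : 'M[R]_n :=
  proj_mx D (orth G D).

Definition almost_contact_metric (R : realType) (m : nat) (M : manifold R m)
    (phi : M -> 'M[R]_m) (zeta : M -> 'rV[R]_m) (eta : M -> 'cV[R]_m)
    (g : M -> 'M[R]_m) : Prop :=
  [/\ odd m,
      [/\ smooth_endo phi, smooth_vfield zeta, smooth_form eta
        & riemannian_metric g],
      [/\ forall p P, P *m phi p *m phi p = - P + ev (eta p) P *: zeta p,
          forall p, zeta p *m phi p = 0,
          forall p P, ev (eta p) (P *m phi p) = 0
        & forall p, ev (eta p) (zeta p) = 1]
    & [/\ forall p P, ip (g p) P (zeta p) = ev (eta p) P,
          forall p P Q, ip (g p) (P *m phi p) (Q *m phi p)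
            = ip (g p) P Q - ev (eta p) P * ev (eta p) Q
        & forall p P Q, ip (g p) (P *m phi p) Q
            = - ip (g p) P (Q *m phi p)]].

Definition sasakian (R : realType) (m : nat) (M : manifold R m)
    (phi : M -> 'M[R]_m) (zeta : M -> 'rV[R]_m) (eta : M -> 'cV[R]_m)
    (g : M -> 'M[R]_m)
    (nabla : (M -> 'rV[R]_m) -> (M -> 'rV[R]_m) -> M -> 'rV[R]_m) : Prop :=
  [/\ almost_contact_metric phi zeta eta g,
      forall P Q p, smooth_vfield P -> smooth_vfield Q ->
        nabla P (tapp phi Q) p - nabla P Q p *m phi p
        = ip (g p) (P p) (Q p) *: zeta p - ev (eta p) (Q p) *: P p
    & forall P p, smooth_vfield P -> nabla P zeta p = - (P p *m phi p)].

Definition ver (R : realType) (m n : nat) (M : manifold R m)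
    (N : manifold R n) (Psi : M -> N) (p : M) : 'M[R]_m := kermx (tmap Psi p).

Definition hor (R : realType) (m n : nat) (M : manifold R m)
    (N : manifold R n) (gM : M -> 'M[R]_m) (Psi : M -> N) (p : M)
    : 'M[R]_m := orth (gM p) (ver Psi p).

Definition vproj (R : realType) (m n : nat) (M : manifold R m)
    (N : manifold R n) (gM : M -> 'M[R]_m) (Psi : M -> N) (p : M)
    : 'M[R]_m := oproj (gM p) (ver Psi p).

Definition hproj (R : realType) (m n : nat) (M : manifold R m)
    (N : manifold R n) (gM : M -> 'M[R]_m) (Psi : M -> N) (p : M)
    : 'M[R]_m := oproj (gM p) (hor gM Psi p).

Definition horizontally_conformal_submersion (R : realType) (m n : nat)
    (M : manifold R m) (N : manifold R n) (gM : M -> 'M[R]_m)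
    (gN : N -> 'M[R]_n) (Psi : M -> N) (lambda : M -> R) : Prop :=
  [/\ (n < m)%N,
      [/\ smooth_map Psi, forall y : N, exists p, Psi p = y
        & forall p, row_full (tmap Psi p)],
      smooth_fun lambda /\ (forall p, 0 < lambda p)
    & forall p U V, (U <= hor gM Psi p)%MS -> (V <= hor gM Psi p)%MS ->
        ip (gN (Psi p)) (U *m tmap Psi p) (V *m tmap Psi p)
        = lambda p ^+ 2 * ip (gM p) U V].

Definition oneill_T (R : realType) (m n : nat) (M : manifold R m)
    (N : manifold R n) (gM : M -> 'M[R]_m)
    (nabla : (M -> 'rV[R]_m) -> (M -> 'rV[R]_m) -> M -> 'rV[R]_m)
    (Psi : M -> N) (E F : M -> 'rV[R]_m) : M -> 'rV[R]_m :=
  let V := tapp (vproj gM Psi) in let H := tapp (hproj gM Psi) in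
  fun p => H (nabla (V E) (V F)) p + V (nabla (V E) (H F)) p.

Definition second_fundamental_form (R : realType) (m n : nat)
    (M : manifold R m) (N : manifold R n)
    (nabla : (M -> 'rV[R]_m) -> (M -> 'rV[R]_m) -> M -> 'rV[R]_m)
    (nablaPsi : (M -> 'rV[R]_m) -> (M -> 'rV[R]_n) -> M -> 'rV[R]_n)
    (Psi : M -> N) (E F : M -> 'rV[R]_m) : M -> 'rV[R]_n :=
  fun p => nablaPsi E (tapp (tmap Psi) F) p - nabla E F p *m tmap Psi p.

Definition D2 (R : realType) (m n : nat) (M : manifold R m)
    (N : manifold R n) (gM : M -> 'M[R]_m) (Psi : M -> N) (D1 : M -> 'M[R]_m)
    (p : M) : 'M[R]_m := (ver Psi p :&: orth (gM p) (D1 p))%MS.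

Definition mu (R : realType) (m n : nat) (M : manifold R m)
    (N : manifold R n) (phi gM : M -> 'M[R]_m) (Psi : M -> N)
    (D1 : M -> 'M[R]_m) (p : M) : 'M[R]_m :=
  (hor gM Psi p :&: orth (gM p) (D2 gM Psi D1 p *m phi p))%MS.

(* alpha P and beta P: the components of phi P in D2 and in mu. *)
Definition alpha (R : realType) (m n : nat) (M : manifold R m)
    (N : manifold R n) (phi gM : M -> 'M[R]_m) (Psi : M -> N)
    (D1 : M -> 'M[R]_m) (P : M -> 'rV[R]_m) : M -> 'rV[R]_m :=
  fun p => P p *m phi p *m oproj (gM p) (D2 gM Psi D1 p).

Definition beta (R : realType) (m n : nat) (M : manifold R m)
    (N : manifold R n) (phi gM : M -> 'M[R]_m) (Psi : M -> N)
    (D1 : M -> 'M[R]_m) (P : M -> 'rV[R]_m) : M -> 'rV[R]_m :=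
  fun p => P p *m phi p *m oproj (gM p) (mu phi gM Psi D1 p).

Definition semi_invariant_conformal_submersion (R : realType) (m n : nat)
    (M : manifold R m) (N : manifold R n)
    (phi : M -> 'M[R]_m) (zeta : M -> 'rV[R]_m) (gM : M -> 'M[R]_m)
    (gN : N -> 'M[R]_n) (Psi : M -> N) (lambda : M -> R)
    (D1 : M -> 'M[R]_m) : Prop :=
  [/\ horizontally_conformal_submersion gM gN Psi lambda,
      forall p, (zeta p <= hor gM Psi p)%MS,
      smooth_distribution D1 /\ (forall p, (D1 p <= ver Psi p)%MS)
    & forall p, (D1 p *m phi p :=: D1 p)%MS /\
        (D2 gM Psi D1 p *m phi p <= hor gM Psi p)%MS].

(* Main.v *)
Require Import Defs.
From HB Require Import structures.
From mathcomp Require Import all_boot all_order all_algebra.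
From mathcomp Require Import all_classical all_reals all_analysis.
From mathcomp Require Import perm ring lra.

(** The Reeb field zeta forces much more structure than the definitions show.

    For vertical X and Y the bracket of X and Y is vertical, hence orthogonal to
    zeta; since nabla zeta = - phi, its zeta-component is also 2 g(phi X, Y)
    ([phi_ver_orth]). So phi maps vertical vectors to horizontal ones, the
    phi-invariant distribution D1 is zero and D2 is the whole vertical
    distribution ([D1_eq0], [D2_ver]). So phi U = 0 for sections U of D1, and the
    theorem characterises the submersions with totally geodesic fibres.

    By the formula for the second fundamental form of a conformal submersion
    ([conformal_sff]) the displayed identity says that
      g(nabla_(phi xi) W, beta Z) = g(phi xi, nabla_W (alpha Z))
    for all vertical W, xi and horizontal Z ([formula_core]). Taking Z = phi V
    with V vertical, and then Z with vanishing alpha Z, splits it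
    ([formula_parts]) into
      (a) nabla_W V is orthogonal to phi xi for all vertical W, V, xi;
      (b) nabla_(phi xi) W is orthogonal to Y for all vertical W, xi and all Y
          that are orthogonal to the fibre, to its image under phi and to zeta.
    Totally geodesic fibres mean (a) together with
      (c) nabla_xi W is orthogonal to Y, for the same W, xi, Y,
    the component of nabla_xi W along zeta being zero in any case.

    It remains to pass between (b) and (c), and this is done by the flow of
    zeta. The field zeta is Killing, so the flow preserves nabla
    ([killing_nab]), and it preserves phi. Conformality, tested on zeta itself,
    shows that the dilation is constant along the fibres, and tested on zeta
    and another horizontal field it shows that the Lie bracket of zeta with a
    vertical field W equals 2 phi W modulo vertical fields ([lie_reeb_ver]).
    The flow of zeta thus rotates W into phi W and phi W into - W, while
    keeping the distribution of the Y above. Differentiating (c) along zeta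
    therefore gives (b) ([geodesic_parts]), and differentiating (b) along zeta
    gives (c) ([parts_transverse]).

    The pointwise argument needs many global smooth fields: extensions of given
    vectors, horizontal and vertical parts, local frames with a cut-off. These,
    and the torsion-freeness and metricity of the pulled-back connection, are
    obtained by testing sections against smooth functions ([smooth_sectionP]). *)

Set Implicit Arguments.
Unset Strict Implicit.
Unset Printing Implicit Defensive.

Import Order.TTheory GRing.Theory Num.Theory.
Import numFieldNormedType.Exports.

Local Open Scope classical_set_scope.
Local Open Scope ring_scope.

(** * Calculus of C^k maps *)

Section Calculus.
Context {R : realType}.

Lemma diff_near (V W : normedModType R) (f g : V -> W) x :
  (\forall y \near x, f y = g y) -> differentiable f x ->
  differentiable g x /\ 'd g x = 'd f x :> (V -> W).
Proof.
move=> fg df.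
have fgx : f x = g x by exact: nbhs_singleton fg.
have cdf : continuous ('d f x) by exact: diff_continuous.
have key : g \o shift x = cst (g x) + 'd f x +o_ 0 id.
  have /eqaddoP H := diff_locally df.
  apply/eqaddoP => e e0; rewrite -fgx.
  move: fg; rewrite (near_shift 0 x) subr0 => fg.
  by apply: filterS2 fg (H e e0) => h /= E; rewrite !fctE /= E.
have E := diff_unique cdf key.
by split=> //; apply/diff_locallyP; rewrite E.
Qed.

Lemma Ck_sub (V W : normedModType R) k (A B : set V) (f : V -> W) :
  A `<=` B -> Ck k B f -> Ck k A f.
Proof.
move=> AB; elim: k f => [|k IH] f /=; first by move=> H x /AB /H.
by move=> [H1 H2]; split=> [x /AB /H1 //|v]; exact: IH.
Qed.

(** [Ck] only asks for pointwise properties of derivatives, so being C^k is a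
    local condition. *)
Lemma Ck_local (V W : normedModType R) k (A : set V) (f : V -> W) :
  (forall x, A x -> exists2 B, B x & Ck k B f) -> Ck k A f.
Proof.
elim: k f => [|k IH] f /= H.
  by move=> x /H [B Bx]; exact.
split=> [x /H [B Bx [+ _]]|v]; first exact.
by apply: IH => x /H [B Bx [_ HB]]; exists B.
Qed.

(** Derivatives only depend on germs; this is where openness enters. *)
Lemma Ck_eq (V W : normedModType R) k (A : set V) (f g : V -> W) :
  open A -> (forall x, A x -> f x = g x) -> Ck k A f -> Ck k A g.
Proof.
move=> oA; elim: k f g => [|k IH] f g fg /=.
  move=> H x Ax.
  have fgx : \forall y \near x, f y = g y.
    by apply: filterS (open_nbhs_nbhs (conj oA Ax)) => y /fg.
  have h : f @ x --> f x := H x Ax; rewrite (fg x Ax) in h.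
  apply: cvg_trans h.
  by apply: near_eq_cvg; apply: filterS fgx => y ->.
have fgx x : A x -> \forall y \near x, f y = g y.
  by move=> Ax; apply: filterS (open_nbhs_nbhs (conj oA Ax)) => y /fg.
move=> [H1 H2]; split=> [x Ax|v].
  by have [] := diff_near (fgx x Ax) (H1 x Ax).
apply: IH (H2 v) => x Ax.
by have [_ ->] := diff_near (fgx x Ax) (H1 x Ax).
Qed.

Lemma CkS (V W : normedModType R) k (A : set V) (f : V -> W) :
  Ck k.+1 A f -> Ck k A f.
Proof.
elim: k f => [|k IH] f /=.
  by move=> [H _] x /H; exact: differentiable_continuous.
by move=> [H1 H2]; split=> // v; exact: IH (H2 v).
Qed.

Lemma Ck_cst (V W : normedModType R) k (A : set V) (a : W) :
  Ck k A (cst a : V -> W).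
Proof.
elim: k a => [|k IH] a /=; first by move=> x _; exact: cst_continuous.
split=> // v.
have -> : (fun x => 'd (cst a : V -> W) x v) = cst 0 by apply/funext => x; rewrite diff_cst.
exact: IH.
Qed.

Lemma CkD (V W : normedModType R) k (A : set V) (f g : V -> W) : open A ->
  Ck k A f -> Ck k A g -> Ck k A (fun x => f x + g x).
Proof.
move=> oA; elim: k f g => [|k IH] f g /=.
  by move=> Hf Hg x Ax; apply: continuousD; [exact: Hf|exact: Hg].
move=> [f1 f2] [g1 g2]; split=> [x Ax|v].
  by apply: differentiableD; [exact: f1|exact: g1].
apply: Ck_eq (IH _ _ (f2 v) (g2 v)) => // x Ax.
exact: (esym (congr1 (@^~ v) (diffD (f1 x Ax) (g1 x Ax)))).
Qed.

Lemma CkM (V : normedModType R) k (A : set V) (f g : V -> R^o) : open A ->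
  Ck k A f -> Ck k A g -> Ck k A (fun x => f x * g x : R^o).
Proof.
move=> oA; elim: k f g => [|k IH] f g.
  by move=> /= Hf Hg x Ax; apply: continuousM; [exact: Hf|exact: Hg].
move=> cf cg; have [f1 f2] := cf; have [g1 g2] := cg; split=> [x Ax|v].
  by apply: differentiableM; [exact: f1|exact: g1].
apply: (Ck_eq (f := fun x => f x * 'd g x v + g x * 'd f x v : R^o)) => //.
  by move=> x Ax; exact: (esym (congr1 (@^~ v) (diffM (f1 x Ax) (g1 x Ax)))).
by apply: CkD => //; apply: IH; [exact: CkS cf|exact: g2|exact: CkS cg|exact: f2].
Qed.

Lemma Ck_sum (V W : normedModType R) k (A : set V) I (r : seq I) (F : I -> V -> W) :
  open A -> (forall i, Ck k A (F i)) -> Ck k A (fun x => \sum_(i <- r) F i x).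
Proof.
move=> oA H; elim: r => [|i r IH].
  by apply: Ck_eq (Ck_cst k A 0) => // x _; rewrite big_nil.
by apply: Ck_eq (CkD oA (H i) IH) => // x _; rewrite big_cons.
Qed.

Lemma CkV (V : normedModType R) k (A : set V) (f : V -> R^o) : open A ->
  (forall x, A x -> f x != 0) -> Ck k A f -> Ck k A (fun x => (f x)^-1 : R^o).
Proof.
move=> oA f0; elim: k => [|k IH].
  by move=> /= Hf x Ax; apply: continuousV; [exact: f0|exact: Hf].
move=> cf; have [f1 f2] := cf; split=> [x Ax|v].
  by apply: differentiableV; [exact: f1|exact: f0].
have c' := IH (CkS cf).
apply: (Ck_eq (f := fun x => (cst (-1) x * ((f x)^-1 * (f x)^-1)) * 'd f x v : R^o)) => //.
  move=> x Ax; rewrite /= mulN1r -invfM -expr2.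
  exact: (esym (congr1 (@^~ v) (diffV (f1 x Ax) (f0 x Ax)))).
exact: CkM oA (CkM oA (Ck_cst k A (-1 : R^o)) (CkM oA c' c')) (f2 v).
Qed.

Lemma Ck_lin (V W : normedModType R) k (A : set V) (L : {linear V -> W}) :
  continuous L -> Ck k A L.
Proof.
move=> cL; case: k => [|k] /=; first by move=> x _; exact: cL.
split=> [x _|v]; first exact: linear_differentiable.
rewrite (_ : (fun x => _) = cst (L v)); first exact: Ck_cst.
by apply/funext => x; rewrite diff_lin.
Qed.

Lemma Ck_lin_comp (U V W : normedModType R) k (A : set U) (L : {linear V -> W}) f :
  open A -> continuous L -> Ck k A f -> Ck k A (L \o f).
Proof.
move=> oA cL; elim: k f => [|k IH] f /=.
  by move=> H x Ax; apply: continuous_comp; [exact: H|exact: cL].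
move=> [f1 f2]; split=> [x Ax|v].
  by apply: differentiable_comp; [exact: f1|exact: linear_differentiable].
apply: Ck_eq (IH _ (f2 v)) => // x Ax /=.
have /(congr1 (@^~ v)) /= -> := diff_comp (f1 x Ax) (linear_differentiable (f x) cL).
by rewrite diff_lin.
Qed.
End Calculus.

Section CalculusRn.
Context {R : realType}.

Lemma CkZl (V W : normedModType R) k (A : set V) (f : V -> R^o) (w : W) :
  open A -> Ck k A f -> Ck k A (fun x => f x *: w).
Proof.
move=> oA; elim: k f => [|k IH] f /=.
  by move=> H x Ax; apply: continuousZr_tmp; exact: H.
move=> [f1 f2]; split=> [x Ax|v].
  by apply: differentiableZl; exact: f1.
apply: Ck_eq (IH _ (f2 v)) => // x Ax.
exact: (esym (congr1 (@^~ v) (diffZl w (f1 x Ax)))).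
Qed.

Lemma Ck_coord (V : normedModType R) n k (A : set V) (f : V -> 'rV[R]_n) j :
  open A -> Ck k A f -> Ck k A (fun x => f x 0 j : R^o).
Proof.
move=> oA cf.
have glin : linear (fun u : 'rV[R]_n => u 0 j : R^o).
  by move=> a u v; rewrite !mxE.
pose glM := GRing.isLinear.Build _ _ _ _ _ glin.
pose gL : {linear _ -> _} := HB.pack (fun u : 'rV[R]_n => u 0 j : R^o) glM.
by apply: (Ck_lin_comp (L := gL)) => //; exact: coord_continuous.
Qed.

Lemma Ck_row (V : normedModType R) n k (A : set V) (f : V -> 'rV[R]_n) :
  open A -> (forall j, Ck k A (fun x => f x 0 j : R^o)) -> Ck k A f.
Proof.
move=> oA cf.
apply: (Ck_eq (f := fun x => \sum_(j < n) f x 0 j *: delta_mx 0 j)) => //.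
  by move=> x _; rewrite -row_sum_delta.
by apply: Ck_sum => // j; exact: CkZl.
Qed.

(** The derivative of g at f x is applied to a moving vector, while [Ck] speaks
    of derivatives in fixed directions; expanding that vector in the canonical
    basis reduces to products of the latter. *)
Lemma Ck_comp (V : normedModType R) n k (A : set V) (B : set 'rV[R]_n)
    (f : V -> 'rV[R]_n) (g : 'rV[R]_n -> R^o) : open A -> open B ->
  (forall x, A x -> B (f x)) -> Ck k A f -> Ck k B g -> Ck k A (g \o f).
Proof.
move=> oA oB AB; elim: k g => [|k IH] g.
  move=> /= cf cg x Ax; apply: continuous_comp; first exact: cf.
  exact: cg _ (AB _ Ax).
move=> cf cg; have [f1 f2] := cf; have [g1 g2] := cg; split=> [x Ax|v].
  by apply: differentiable_comp; [exact: f1|exact: g1 _ (AB _ Ax)].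
apply: (Ck_eq (f := fun x => \sum_(i < n)
    ('d f x v 0 i * 'd g (f x) (delta_mx 0 i)) : R^o)) => //.
  move=> x Ax.
  have /(congr1 (@^~ v)) /= -> := diff_comp (f1 x Ax) (g1 _ (AB _ Ax)).
  rewrite [in RHS](row_sum_delta ('d f x v)) linear_sum.
  by apply: eq_bigr => i _; rewrite linearZ.
apply: Ck_sum => // i.
exact: CkM oA (Ck_coord i oA (f2 v)) (IH _ (CkS cf) (g2 _)).
Qed.

End CalculusRn.

(** * Flat functions and bumps *)

Section Flat.
Context {R : realType}.

(** The functions p(1/t) exp(-1/t), extended by 0 to t <= 0, form a class that
    is stable under differentiation; p = 1 is the classical flat function from
    which cut-off functions are made. *)
Definition flat (p : {poly R}) (t : R) : R :=
  if 0 < t then p.[t^-1] * expR (- t^-1) else 0.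

Lemma flat_pos p t : 0 < t -> flat p t = p.[t^-1] * expR (- t^-1).
Proof. by rewrite /flat => ->. Qed.

Lemma flat_neg p t : t <= 0 -> flat p t = 0.
Proof. by rewrite /flat ltNge => ->. Qed.

(** exp beats every polynomial, here in the form needed at t = 0. *)
Lemma flat_bound p : exists2 C, 0 < C & forall t, 0 < t -> t <= 1 ->
  `|flat p t| <= C * t ^+ 2.
Proof.
set n := (size p).+1.
set S := \sum_(i < size p) `|p`_i|.
have S0 : 0 <= S by apply: sumr_ge0.
have F0 : 0 < (n.+1)`!%:R :> R by rewrite ltr0n fact_gt0.
exists (S * (n.+1)`!%:R + 1); first by rewrite ltr_wpDl// mulr_ge0// ltW.
move=> t t0 t1; rewrite flat_pos// normrM (ger0_norm (expR_ge0 _)).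
have s1 : 1 <= t^-1 by rewrite invf_ge1.
have s0 : 0 < t^-1 by rewrite invr_gt0.
have pb : `|p.[t^-1]| <= S * (t^-1) ^+ (n.-1).
  rewrite horner_coef mulr_suml; apply: le_trans (ler_norm_sum _ _ _) _.
  apply: ler_sum => i _; rewrite normrM ler_wpM2l// normrX gtr0_norm//.
  by rewrite ler_weXn2l// ltnW.
have eb : expR (- t^-1) <= (n.+1)`!%:R * t ^+ n.+1.
  rewrite expRN -[leRHS]invrK lef_pV2 ?posrE ?expR_gt0//; last first.
    by rewrite invr_gt0 mulr_gt0// exprn_gt0.
  rewrite invfM mulrC -exprVn; apply: le_trans (expR_ge1Dxn n (ltW s0)).
  by rewrite lerDr.
apply: le_trans (ler_pM (normr_ge0 _) (expR_ge0 _) pb eb) _.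
have -> : S * t^-1 ^+ n.-1 * (n.+1`!%:R * t ^+ n.+1) = S * n.+1`!%:R * t ^+ 2.
  rewrite (_ : n.+1 = 2 + n.-1)%N; last by rewrite /n.
  rewrite exprD exprVn.
  have tn0 : t ^+ n.-1 != 0 by rewrite expf_neq0// gt_eqF.
  by rewrite -(mulrA S) mulrACA; field.
by rewrite ler_wpM2r ?exprn_ge0 1?ltW// ltrDl.
Qed.
End Flat.

Section Bump.
Context {R : realType}.

(** The derivative of p(1/t) exp(-1/t) is q(1/t) exp(-1/t) for this q. *)
Definition flatD (p : {poly R}) : {poly R} := 'X^2 * (p - p^`()).

Lemma flat_is_diff p (t : R) : is_diff t (flat p) (fun h : R => h *: flat (flatD p) t).
Proof.
have [t0|t0|<-] := ltgtP 0 t.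
- pose g := fun s : R => p.[s^-1] * expR (- s^-1).
  have tn0 : t != 0 by rewrite gt_eqF.
  have dg : is_derive t (1 : R) g (flat (flatD p) t).
    have di : is_derive t (1:R) (fun s : R => s^-1) (- t ^- 2).
      apply: is_derive_eq (is_deriveV tn0 (is_derive_id t 1)) _.
      by rewrite scaler1.
    have dp : is_derive t (1:R) (horner p \o (fun s : R => s^-1)) (p^`().[t^-1] * - t ^- 2).
      exact: is_derive1_comp.
    have dn : is_derive t (1:R) (fun s : R => - s^-1) (t ^- 2).
      by apply: is_derive_eq (is_deriveN di) _; rewrite opprK.
    have de : is_derive t (1:R) (expR \o (fun s : R => - s^-1)) (expR (- t^-1) * t ^- 2).
      by apply: is_derive1_comp.
    apply: is_derive_eq (is_deriveM dp de) _.
    rewrite flat_pos// /flatD hornerM hornerXn hornerD hornerN /GRing.scale /=.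
    by rewrite exprVn; ring.
  have fg : \forall y \near t, g y = flat p y.
    by near=> y; rewrite flat_pos//; near: y; exact: lt_nbhsr.
  have dg1 : differentiable g t by apply/derivable1_diffP; exact: ex_derive.
  have [d1 d2] := diff_near fg dg1.
  split=> //; rewrite d2 deriv1E; last exact: ex_derive.
  by rewrite derive1E derive_val.
- have fg : \forall y \near t, cst 0 y = flat p y.
    by near=> y; rewrite flat_neg//; near: y; exact: lt_le_nbhsl.
  have [d1 d2] := diff_near fg (differentiable_cst (0 : R) t).
  split=> //; rewrite d2 diff_cst; apply/funext => h.
  by rewrite (flat_neg _ (ltW t0)) scaler0.
- have -> : (fun h : R => h *: flat (flatD p) 0) = cst 0.
    by apply/funext => h; rewrite (flat_neg _ (lexx 0)) scaler0.
  have [C C0 HC] := flat_bound p.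
  have key : flat p \o shift 0 = cst (flat p 0) + cst 0 +o_ 0 id.
    apply/eqaddoP => e e0.
    have hn : \forall h \near (0 : R), `|h| <= Num.min 1 (e / C).
      by apply: (@nbhs0_le R R); rewrite lt_min ltr01 divr_gt0.
    near=> h.
    rewrite !fctE /= !addr0 (flat_neg p (lexx 0)) subr0.
    have [h0|h0] := leP h 0; first by rewrite flat_neg// normr0 mulr_ge0// ltW.
    have h1 : `|h| <= Num.min 1 (e / C).
      by near: h; exact: hn.
    move: h1; rewrite le_min gtr0_norm// => /andP[h1 h2].
    apply: le_trans (HC h h0 h1) _.
    rewrite expr2 mulrA ler_wpM2r//; first exact: ltW.
    by rewrite (mulrC C) -ler_pdivlMr.
  have lin0 : linear (cst 0 : R -> R) by move=> a u v; rewrite /= scaler0 addr0.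
  pose lM := GRing.isLinear.Build _ _ _ _ _ lin0.
  pose L : {linear R -> R} := HB.pack (cst 0 : R -> R) lM.
  have cL : continuous L by exact: cst_continuous.
  have E : 'd (flat p) 0 = L :> (R -> R) by exact: diff_unique.
  by split=> //; apply/diff_locallyP; rewrite E.
Unshelve. all: by end_near. Qed.

Lemma Ck_flat (V : normedModType R) k (A : set V) (f : V -> R^o) p : open A ->
  Ck k A f -> Ck k A (fun x => flat p (f x) : R^o).
Proof.
move=> oA; elim: k p => [|k IH] p.
  move=> /= cf x Ax; apply: continuous_comp; first exact: cf.
  by apply: differentiable_continuous; have [] := flat_is_diff p (f x).
move=> cf; have [f1 f2] := cf; have df t : differentiable (flat p) t by have [] := flat_is_diff p t.
split=> [x Ax|v].
  by apply: differentiable_comp; [exact: f1|exact: df].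
apply: (Ck_eq (f := fun x => flat (flatD p) (f x) * 'd f x v : R^o)) => //.
  move=> x Ax.
  apply: etrans (esym (congr1 (@^~ v) (diff_comp (f1 x Ax) (df (f x))))).
  have [_ E] := flat_is_diff p (f x).
  by rewrite mulrC; exact: (esym (congr1 (@^~ ('d f x v)) E)).
exact: CkM oA (IH _ (CkS cf)) (f2 v).
Qed.

Lemma Ck_id_coord n k (A : set 'rV[R]_n) j : open A -> Ck k A (fun x : 'rV[R]_n => x 0 j : R^o).
Proof.
move=> oA; apply: (Ck_coord (f := idfun)) => //.
by apply: (Ck_lin k A (L := idfun)) => x; exact: cvg_id.
Qed.

(** With s the squared Euclidean distance to a, c = r^2 and e the flat function,
    e(c - s) / (e(c - s) + e(s - c/2)) is 1 where s <= c/2 and 0 where c <= s.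
    The balls are those of the sup norm, which is at most sqrt s. *)
Lemma bump_Rn n (a : 'rV[R]_n) (r : R) : 0 < r ->
  exists b : 'rV[R]_n -> R^o, [/\ Cinfty setT b, (\forall x \near a, b x = 1)
    & forall x, b x != 0 -> ball a r x].
Proof.
move=> r0; pose s (x : 'rV[R]_n) : R^o := \sum_(i < n) (x 0 i - a 0 i) * (x 0 i - a 0 i).
have ss k : Ck k setT s.
  apply: Ck_sum => [|i]; first exact: openT.
  have c : Ck k setT (fun x : 'rV[R]_n => x 0 i - a 0 i : R^o).
    exact: CkD openT (Ck_id_coord k i openT) (Ck_cst k setT (- a 0 i : R^o)).
  exact: (CkM openT c c).
pose c := r ^+ 2; have c0 : 0 < c by rewrite exprn_gt0.
pose e := flat (1 : {poly R}).
have e_pos t : 0 < t -> 0 < e t by move=> t0; rewrite /e flat_pos// hornerC mul1r expR_gt0.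
have e_ge t : 0 <= e t.
  by have [t0|/e_pos/ltW//] := leP t 0; rewrite /e flat_neg.
pose u (x : 'rV[R]_n) : R^o := e (c - s x).
pose w (x : 'rV[R]_n) : R^o := e (s x - c / 2).
have su k : Ck k setT u.
  have sN : Ck k setT (fun x => c - s x : R^o).
    apply: (Ck_eq (f := fun x => cst c x + cst (-1) x * s x : R^o)); first exact: openT.
      by move=> x _ /=; rewrite mulN1r.
    exact: CkD openT (Ck_cst k setT (c : R^o)) (CkM openT (Ck_cst k setT (-1 : R^o)) (ss k)).
  exact: Ck_flat 1 openT sN.
have sw k : Ck k setT w.
  exact: Ck_flat 1 openT (CkD openT (ss k) (Ck_cst k setT (- (c / 2) : R^o))).
have d0 x : u x + w x != 0.
  rewrite gt_eqF//; have [sc|sc] := ltP (s x) c.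
    by rewrite ltr_pwDl// /u ?e_pos ?subr_gt0// e_ge.
  rewrite ltr_wpDl ?e_ge// e_pos// subr_gt0 (lt_le_trans _ sc)//.
  by rewrite ltr_pdivrMr// ltr_pMr// ltr1n.
exists (fun x => u x * (u x + w x)^-1 : R^o); split.
- move=> k; apply: CkM openT (su k) (CkV openT _ (CkD openT (su k) (sw k))).
  by move=> x _; exact: d0.
- have : \forall x \near a, s x < c / 2.
    have := ss 0 a I; rewrite /continuous_at => /cvgr_lt; apply.
    by rewrite /s big1 ?divr_gt0// => i _; rewrite subrr mul0r.
  apply: filterS => x sx.
  have w0 : w x = 0 by rewrite /w /e flat_neg// subr_le0 ltW.
  by have := d0 x; rewrite w0 addr0 => u0; rewrite divff.
- move=> x bx.
  have sx : s x < c.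
    rewrite ltNge; apply: contra bx => cx.
    by rewrite /u /e flat_neg ?mul0r// subr_le0.
  split=> // i j; rewrite (ord1 i) -ball_normE /= distrC.
  rewrite -(ltr_pXn2r (isT : (0 < 2)%N)) ?nnegrE ?normr_ge0 ?(ltW r0)//.
  apply: le_lt_trans sx; rewrite real_normK ?num_real// expr2 /s (bigD1 j)//=.
  by rewrite lerDl sumr_ge0// => k _; rewrite -expr2 sqr_ge0.
Qed.
End Bump.

(** * Smooth functions on a manifold *)

Section SmoothFunctions.
Context {R : realType} {m : nat} {M : manifold R m}.
Implicit Types (c d : chart R m M) (A B : set M) (p q : M).

Lemma chart_near c p (P : set M) : cdom c p -> (\forall q \near p, P q) ->
  \forall x \near c p, P (cinv c x).
Proof.
move=> cp; have h := @cinv_continuous _ _ _ c (c p) (imageP c cp).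
by move=> Pp; apply: h; rewrite cfunK.
Qed.

Lemma chart_img_near c p : cdom c p -> \forall x \near c p, (c @` cdom c) x.
Proof.
by move=> cp; apply: open_nbhs_nbhs; split; [exact: cimg_open|exact: imageP].
Qed.

(** A chart is a homeomorphism onto its image. *)
Lemma img_open c A : open A -> open (c @` (cdom c `&` A)).
Proof.
move=> oA; rewrite openE => _ [p [cp Ap] <-]; rewrite /interior.
have near_A : \forall x \near c p, A (cinv c x).
  by apply: chart_near => //; exact: open_nbhs_nbhs.
apply: filterS2 near_A (chart_img_near cp) => x + [q cq xq].
by rewrite -xq cfunK// => Aq; exists q.
Qed.

Lemma near_open p (P : set M) : (\forall q \near p, P q) ->
  exists A, [/\ open A, A p & forall q, A q -> P q].
Proof.
move=> H; exists (P^°); split; [exact: open_interior|exact: H|].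
by move=> q; exact: interior_subset.
Qed.

Lemma open_near p A : open A -> A p -> \forall q \near p, A q.
Proof. by move=> oA Ap; apply: open_nbhs_nbhs. Qed.

Lemma smooth_on_eq (W : normedModType R) A (g h : M -> W) : open A ->
  (forall q, A q -> g q = h q) -> smooth_on A g -> smooth_on A h.
Proof.
move=> oA gh sg c cA k; apply: Ck_eq (sg c cA k); first exact: img_open.
by move=> _ [q [cq Aq] <-] /=; rewrite cfunK// gh.
Qed.

Lemma smooth_on_sub (W : normedModType R) A B (h : M -> W) :
  A `<=` B -> smooth_on B h -> smooth_on A h.
Proof.
move=> AB sh c cA k; apply: Ck_sub (sh c cA k).
by apply: image_subset => q [? /AB].
Qed.

Lemma smooth_on_local (W : normedModType R) A (h : M -> W) :
  (forall p, A p -> exists B, [/\ open B, B p & smooth_on B h]) -> smooth_on A h.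
Proof.
move=> H c cA k; apply: Ck_local => _ [p [cp Ap] <-].
have [B [oB Bp sB]] := H p Ap.
by exists (c @` (cdom c `&` B)); [exists p|exact: sB].
Qed.

Lemma smooth_on_cst (W : normedModType R) A (a : W) : smooth_on A (fun _ : M => a).
Proof. by move=> c cA k; exact: (Ck_cst k _ a). Qed.

Lemma smooth_onD (W : normedModType R) A (g h : M -> W) : open A ->
  smooth_on A g -> smooth_on A h -> smooth_on A (fun q => g q + h q).
Proof.
by move=> oA sg sh c cA k; exact: CkD (img_open oA) (sg c cA k) (sh c cA k).
Qed.

Lemma smooth_onM A (g h : M -> R^o) : open A ->
  smooth_on A g -> smooth_on A h -> smooth_on A (fun q => g q * h q : R^o).
Proof.
by move=> oA sg sh c cA k; exact: CkM (img_open oA) (sg c cA k) (sh c cA k).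
Qed.

Lemma smooth_onN A (g : M -> R^o) : open A ->
  smooth_on A g -> smooth_on A (fun q => - g q : R^o).
Proof.
move=> oA sg; apply: (smooth_on_eq (g := fun q => -1 * g q : R^o)) => //.
  by move=> q _; rewrite mulN1r.
exact: smooth_onM oA (smooth_on_cst _ (-1 : R^o)) sg.
Qed.

Lemma smooth_onV A (g : M -> R^o) : open A -> (forall q, A q -> g q != 0) ->
  smooth_on A g -> smooth_on A (fun q => (g q)^-1 : R^o).
Proof.
move=> oA g0 sg c cA k; apply: CkV (img_open oA) _ (sg c cA k).
by move=> _ [q [cq Aq] <-] /=; rewrite cfunK//; exact: g0.
Qed.

Lemma smooth_on_sum A I (r : seq I) (F : I -> M -> R^o) : open A ->
  (forall i, smooth_on A (F i)) -> smooth_on A (fun q => \sum_(i <- r) F i q : R^o).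
Proof.
move=> oA sF c cA k.
exact: (@Ck_sum _ _ _ _ _ _ r (fun i => F i \o cinv c) (img_open oA) (fun i => sF i c cA k)).
Qed.

Lemma smooth_on_prod A I (r : seq I) (F : I -> M -> R^o) : open A ->
  (forall i, smooth_on A (F i)) -> smooth_on A (fun q => \prod_(i <- r) F i q : R^o).
Proof.
move=> oA sF; elim: r => [|i r IH].
  by apply: smooth_on_eq (smooth_on_cst A (1 : R^o)) => // q _; rewrite big_nil.
by apply: smooth_on_eq (smooth_onM oA (sF i) IH) => // q _; rewrite big_cons.
Qed.

Lemma smooth_on_row n A (h : M -> 'rV[R]_n) : open A ->
  smooth_on A h <-> forall j, smooth_on A (fun q => h q 0 j : R^o).
Proof.
move=> oA; split=> [sh j c cA k|sh c cA k].
  exact: Ck_coord j (img_open oA) (sh c cA k).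
by apply: Ck_row (img_open oA) _ => j; exact: sh.
Qed.

Lemma chart_comp_smooth c (g : 'rV[R]_m -> R^o) (O : set 'rV[R]_m) : atlas c ->
  open O -> Cinfty O g -> smooth_on (cdom c `&` c @^-1` O) (g \o c).
Proof.
move=> cA oO sg d dA k.
have oB : open (cdom c `&` c @^-1` O).
  rewrite openE => q [cq Oq]; rewrite /interior; apply: filterI.
    by apply: open_nbhs_nbhs; split => //; exact: cdom_open.
  by apply: (cfun_continuous cq); exact: open_nbhs_nbhs.
apply: (Ck_comp (f := c \o cinv d) (g := g) (B := O)) => //.
- exact: img_open.
- by move=> _ [q [dq [cq Oq]] <-] /=; rewrite cfunK.
- apply: Ck_sub (atlas_compatible dA cA k).
  by apply: image_subset => q [? []].
Qed.

Lemma chart_dom_smooth c (g : 'rV[R]_m -> R^o) : atlas c ->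
  Cinfty (c @` cdom c) g -> smooth_on (cdom c) (g \o c).
Proof.
move=> cA sg; apply: smooth_on_sub (chart_comp_smooth cA (@cimg_open _ _ _ c) sg).
by move=> q cq; split=> //; exists q.
Qed.

Lemma coord_smooth c j : atlas c -> smooth_on (cdom c) (fun q => c q 0 j : R^o).
Proof.
move=> cA; apply: (chart_dom_smooth (g := fun x => x 0 j : R^o)) => // k.
by apply: Ck_id_coord; exact: cimg_open.
Qed.

End SmoothFunctions.

Section SmoothComp.
Context {R : realType} {m n : nat} {M : manifold R m} {N : manifold R n}.

(** In charts the composite factors through a chart of the target. *)
Lemma smooth_map_comp (f : M -> N) (B : set N) (h : N -> R^o) : smooth_map f ->
  open B -> smooth_on B h -> smooth_on (f @^-1` B) (h \o f).
Proof.
move=> [cf sf] oB sh; apply: smooth_on_local => p Bp.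
set d := chart_at (f p); have dA : atlas d by exact: chart_at_atlas.
have oU : open (f @^-1` (cdom d `&` B)).
  apply: open_comp => [x _|]; first exact: cf.
  by apply: openI => //; exact: cdom_open.
exists (f @^-1` (cdom d `&` B)); split=> //.
  by split=> //; exact: chart_at_dom.
move=> c cA k.
apply: (Ck_eq (f := (h \o cinv d) \o (d \o f \o cinv c))).
- exact: img_open.
- by move=> _ [q [cq [dq Bq]] <-] /=; rewrite !cfunK.
apply: (Ck_comp (B := d @` (cdom d `&` B))).
- exact: img_open.
- exact: img_open.
- by move=> _ [q [cq [dq Bq]] <-] /=; rewrite cfunK//; exists (f q).
- apply: Ck_sub (sf d dA c cA k).
  by apply: image_subset => q [? []].
- exact: sh.
Qed.
End SmoothComp.

Lemma smooth_idfun (R : realType) m (M : manifold R m) : smooth_map (idfun : M -> M).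
Proof.
split=> [x|c cA d dA k]; first exact: cvg_id.
exact: atlas_compatible.
Qed.

(** * Derivatives of functions along tangent vectors *)

Section Differentials.
Context {R : realType} {m : nat} {M : manifold R m}.
Implicit Types (c d : chart R m M) (A B : set M) (p q : M).

Lemma smooth_differentiable (W : normedModType R) c A (h : M -> W) p : atlas c ->
  A p -> cdom c p -> smooth_on A h -> differentiable (h \o cinv c) (c p).
Proof. by move=> cA Ap cp sh; have [H _] := sh c cA 1%N; apply: H; exists p. Qed.

Lemma smooth_tdifferentiable (W : normedModType R) A (h : M -> W) p :
  A p -> smooth_on A h -> differentiable (h \o cinv (chart_at p)) (chart_at p p).
Proof.
by move=> Ap; apply: smooth_differentiable => //; [exact: chart_at_atlas|exact: chart_at_dom].
Qed.

Lemma tder_near (W : normedModType R) A (g h : M -> W) p v : A p ->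
  smooth_on A g -> (\forall q \near p, g q = h q) -> tder h p v = tder g p v.
Proof.
move=> Ap sg gh.
have E : \forall x \near chart_at p p,
    (g \o cinv (chart_at p)) x = (h \o cinv (chart_at p)) x.
  exact: chart_near (chart_at_dom p) gh.
have [_ E'] := diff_near E (smooth_tdifferentiable Ap sg).
exact: (congr1 (@^~ v) E').
Qed.

Lemma transition_differentiable c d p : atlas c -> atlas d -> cdom c p -> cdom d p ->
  differentiable (d \o cinv c) (c p).
Proof.
move=> cA dA cp dp; have [H _] := atlas_compatible cA dA 1%N.
by apply: H; exists p.
Qed.

(** Chain rule for a change of charts, valid at p since the two sides come from
    functions that agree near p. *)
Lemma diff_transition (W : normedModType R) c d A (h : M -> W) p v : atlas c -> atlas d ->
  cdom c p -> cdom d p -> A p -> smooth_on A h ->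
  'd (h \o cinv d) (d p) v = 'd (h \o cinv c) (c p) ('d (c \o cinv d) (d p) v).
Proof.
move=> cA dA cp dp Ap sh.
have E : \forall x \near d p,
    ((h \o cinv c) \o (c \o cinv d)) x = (h \o cinv d) x.
  have : \forall x \near d p, cdom c (cinv d x).
    exact: chart_near (open_near (@cdom_open _ _ _ c) cp).
  by apply: filterS => x cx /=; rewrite cfunK.
have d1 := transition_differentiable dA cA dp cp.
have d2 : differentiable (h \o cinv c) ((c \o cinv d) (d p)).
  by rewrite /= cfunK//; exact: smooth_differentiable sh.
have [_ E'] := diff_near E (differentiable_comp d1 d2).
apply: etrans (congr1 (@^~ v) E') _.
apply: etrans (congr1 (@^~ v) (diff_comp d1 d2)) _.
by rewrite /= cfunK.
Qed.

Lemma tder_chart (W : normedModType R) c A (h : M -> W) p v : atlas c ->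
  cdom c p -> A p -> smooth_on A h ->
  tder h p v = 'd (h \o cinv c) (c p) (tder c p v).
Proof.
move=> cA cp Ap sh; apply: diff_transition Ap sh => //.
  exact: chart_at_atlas.
exact: chart_at_dom.
Qed.

Lemma dfun_near A (g h : M -> R) p v : A p -> smooth_on A (g : M -> R^o) ->
  (\forall q \near p, g q = h q) -> dfun h p v = dfun g p v.
Proof. exact: tder_near. Qed.

Lemma dfunDr (h : M -> R) p u v : dfun h p (u + v) = dfun h p u + dfun h p v.
Proof. by rewrite /dfun /tder linearD. Qed.

Lemma dfunZr (h : M -> R) p a v : dfun h p (a *: v) = a * dfun h p v.
Proof. by rewrite /dfun /tder linearZ. Qed.

Lemma dfunNr (h : M -> R) p v : dfun h p (- v) = - dfun h p v.
Proof. by rewrite /dfun /tder linearN. Qed.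

Lemma dfun0r (h : M -> R) p : dfun h p 0 = 0.
Proof. by rewrite /dfun /tder linear0. Qed.

Lemma dfun_sumr I (r : seq I) (h : M -> R) p (F : I -> 'rV[R]_m) :
  dfun h p (\sum_(i <- r) F i) = \sum_(i <- r) dfun h p (F i).
Proof. by rewrite /dfun /tder linear_sum. Qed.

Lemma dfun_cst (a : R) p v : dfun (fun _ : M => a) p v = 0.
Proof. by rewrite /dfun /tder; have -> := diff_cst (V := 'rV[R]_m) (a : R^o) (chart_at p p). Qed.

Lemma dfunD A (g h : M -> R) p v : A p -> smooth_on A (g : M -> R^o) ->
  smooth_on A (h : M -> R^o) ->
  dfun (fun q => g q + h q) p v = dfun g p v + dfun h p v.
Proof.
move=> Ap sg sh.
exact: (congr1 (@^~ v) (diffD (smooth_tdifferentiable Ap sg) (smooth_tdifferentiable Ap sh))).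
Qed.

Lemma dfunM A (g h : M -> R) p v : A p -> smooth_on A (g : M -> R^o) ->
  smooth_on A (h : M -> R^o) ->
  dfun (fun q => g q * h q) p v = g p * dfun h p v + h p * dfun g p v.
Proof.
move=> Ap sg sh.
have E := congr1 (@^~ v) (diffM (smooth_tdifferentiable Ap sg) (smooth_tdifferentiable Ap sh)).
apply: etrans E _ => /=.
by rewrite cfunK//; exact: chart_at_dom.
Qed.

Lemma tder_coord A n (h : M -> 'rV[R]_n) p v j : A p -> smooth_on A h ->
  tder h p v 0 j = dfun (fun q => h q 0 j) p v.
Proof.
move=> Ap sh; have dh := smooth_tdifferentiable Ap sh.
have glin : linear (fun u : 'rV[R]_n => u 0 j : R^o).
  by move=> a u w; rewrite !mxE.
pose glM := GRing.isLinear.Build _ _ _ _ _ glin.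
pose gL : {linear _ -> _} := HB.pack (fun u : 'rV[R]_n => u 0 j : R^o) glM.
have cL : continuous gL by exact: coord_continuous.
have dL := linear_differentiable (h p) cL.
rewrite /dfun /tder.
have E := congr1 (@^~ v) (diff_comp dh (linear_differentiable
   ((h \o cinv (chart_at p)) (chart_at p p)) cL)).
apply: esym; apply: etrans E _ => /=.
exact: (congr1 (@^~ _) (diff_lin ((h \o cinv (chart_at p)) (chart_at p p)) cL)).
Qed.

End Differentials.

Section DifferentialComp.
Context {R : realType} {m n : nat} {M : manifold R m} {N : manifold R n}.

(** The chain rule, with the differential of f acting on row vectors. *)
Lemma dfun_comp (f : M -> N) (B : set N) (h : N -> R) p v : smooth_map f ->
  open B -> B (f p) -> smooth_on B (h : N -> R^o) ->
  dfun (h \o f) p v = dfun h (f p) (v *m tmap f p).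
Proof.
move=> [cf sf] oB Bp sh.
pose c := chart_at p; pose d := chart_at (f p).
have cp : cdom c p by exact: chart_at_dom.
have dp : cdom d (f p) by exact: chart_at_dom.
have E : \forall x \near c p,
    ((h \o cinv d) \o (d \o f \o cinv c)) x = ((h \o f) \o cinv c) x.
  have nd : \forall q \near p, cdom d (f q).
    by apply: cf; apply: open_near => //; exact: cdom_open.
  have := chart_near cp nd.
  by apply: filterS => x dx /=; rewrite cfunK.
have d1 : differentiable (d \o f \o cinv c) (c p).
  have [H _] := sf d (chart_at_atlas _) c (chart_at_atlas _) 1%N.
  by apply: H; exists p.
have d2 : differentiable (h \o cinv d : _ -> R^o) ((d \o f \o cinv c) (c p)).
  by rewrite /= cfunK//; exact: smooth_tdifferentiable Bp sh.
have [_ E'] := diff_near E (differentiable_comp d1 d2).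
rewrite /dfun /tder -/c -/d.
apply: etrans (congr1 (@^~ v) E') _.
apply: etrans (congr1 (@^~ v) (diff_comp d1 d2)) _.
by rewrite /tmap /jacobian mul_rV_lin1 /= cfunK.
Qed.

End DifferentialComp.

(** * Cut-offs and smooth sections *)

Section Cutoff.
Context {R : realType} {m : nat} {M : manifold R m}.
Implicit Types (c d : chart R m M) (A B : set M) (p q : M).

(** A bump in a chart, extended by 0. The closed ball that carries it is compact,
    so its preimage is compact, hence closed because M is Hausdorff; B is the
    complement of that preimage. *)
Lemma cutoff A p : open A -> A p ->
  exists (chi : M -> R) (B : set M), [/\ smooth_fun chi,
    (\forall q \near p, chi q = 1), open B, (forall q, A q \/ B q)
    & forall q, B q -> chi q = 0].
Proof.
move=> oA Ap; pose c := chart_at p.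
have cA : atlas c by exact: chart_at_atlas.
have cp : cdom c p by exact: chart_at_dom.
have oO : open (c @` (cdom c `&` A)) by exact: img_open.
have Op : (c @` (cdom c `&` A)) (c p) by exists p.
have /nbhs_ballP[e /= e0 He] := open_nbhs_nbhs (conj oO Op).
pose r := e / 2; have r0 : 0 < r by rewrite divr_gt0.
have [b [sb b1 b0]] := bump_Rn (c p) r0.
pose K := closed_ball (c p) r.
have KO : K `<=` c @` (cdom c `&` A).
  apply: subset_trans He; apply: closed_ball_subset => //.
  by rewrite /r ltr_pdivrMr// ltr_pMr// ltr1n.
have cK : compact K.
  apply: bounded_closed_compact; last exact: closed_ball_closed.
  exists (`|c p| + r); split; first exact: num_real.
  move=> x xr y; rewrite /K closed_ballE//= => yr.
  apply: le_trans (ltW xr).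
  by rewrite -[y](subrK (c p)) addrC (le_trans (ler_normD _ _))// lerD2l distrC.
pose K' := cinv c @` K.
have cK' : compact K'.
  apply: continuous_compact => //.
  apply: continuous_in_subspaceT => x; rewrite inE => /KO [q [cq _] <-].
  by apply: cinv_continuous; exists q.
have clK' : closed K' by apply: compact_closed => //; exact: manifold_hausdorff.
have K'A q : K' q -> cdom c q /\ A q.
  by move=> [x /KO [q' [cq' Aq'] <-] <-]; rewrite cfunK.
pose chi q : R := if `[< cdom c q >] then b (c q) else 0.
have chiE q : cdom c q -> chi q = b (c q) by move=> cq; rewrite /chi asboolT.
have chi0 q : ~ K' q -> chi q = 0.
  rewrite /chi; case: asboolP => // cq nK; apply/eqP; apply: contra_notT nK => bq.
  exists (c q); last by rewrite cfunK.
  by apply: subset_closure; exact: b0.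
have oK' : open (~` K') by exact: closed_openC.
exists chi, (~` K'); split=> //.
- apply: smooth_on_local => q _; have [cq|ncq] := pselect (cdom c q).
    exists (cdom c); split=> //; first exact: cdom_open.
    apply: (smooth_on_eq (g := b \o c)) (@cdom_open _ _ _ c) _ _.
      by move=> q' cq'; rewrite chiE.
    apply: chart_dom_smooth => // k.
    by apply: Ck_sub (sb k).
  exists (~` K'); split=> //; first by move=> /K'A [].
  apply: (smooth_on_eq (g := fun=> 0 : R^o)) oK' _ (smooth_on_cst _ _).
  by move=> q' nK; rewrite chi0.
- have nc : \forall q \near p, b (c q) = 1 by exact: cfun_continuous cp _ b1.
  apply: filterS2 nc (open_near (@cdom_open _ _ _ c) cp) => q bq cq.
  by rewrite chiE.
- by move=> q; have [/K'A []|] := pselect (K' q); [left|right].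
Qed.

(** On A the product is smooth, and on B it is 0; A and B cover M. *)
Lemma cutoff_smooth A B (chi g : M -> R) : open A -> open B ->
  (forall q, A q \/ B q) -> (forall q, B q -> chi q = 0) -> smooth_fun chi ->
  smooth_on A (g : M -> R^o) -> smooth_fun (fun q => chi q * g q).
Proof.
move=> oA oB AB chi0 schi sg; apply: smooth_on_local => q _.
have [Aq|Bq] := AB q.
  exists A; split=> //.
  by apply: smooth_onM oA _ sg; apply: smooth_on_sub schi.
exists B; split=> //.
apply: (smooth_on_eq (g := fun=> 0 : R^o)) oB _ (smooth_on_cst _ _).
by move=> q' Bq'; rewrite chi0// mul0r.
Qed.

Lemma extend_fun A p (g : M -> R) : open A -> A p -> smooth_on A (g : M -> R^o) ->
  exists2 h : M -> R, smooth_fun h & \forall q \near p, h q = g q.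
Proof.
move=> oA Ap sg; have [chi [B [schi chi1 oB AB chi0]]] := cutoff oA Ap.
exists (fun q => chi q * g q); first exact: cutoff_smooth AB chi0 schi sg.
by apply: filterS chi1 => q ->; rewrite mul1r.
Qed.

End Cutoff.

Lemma linear_rowE (R : realType) n (L : {linear 'rV[R]_n -> R^o}) v :
  L v = \sum_(j < n) v 0 j * L (delta_mx 0 j).
Proof.
rewrite {1}(row_sum_delta v) linear_sum.
by apply: eq_bigr => j _; rewrite linearZ.
Qed.

Section Sections.
Context {R : realType} {m n : nat} {M : manifold R m} {N : manifold R n}.
Implicit Types (f : M -> N) (s : M -> 'rV[R]_n) (A : set M).

Lemma preimage_open f (B : set N) : smooth_map f -> open B -> open (f @^-1` B).
Proof. by move=> [cf _] oB; apply: open_comp => [x _|//]; exact: cf. Qed.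

(** A section is tested by the functions on the target: its components in a
    chart are the derivatives of cut-off coordinates. *)
Lemma smooth_sectionP f A s : smooth_map f -> open A ->
  smooth_section_on f A s <->
  forall h : N -> R, smooth_fun h -> smooth_on A (fun p => dfun h (f p) (s p) : R^o).
Proof.
move=> sf oA; split=> [ss h sh|H c cA].
  apply: smooth_on_local => p Ap; pose c := chart_at (f p).
  have cA : atlas c by exact: chart_at_atlas.
  have cp : cdom c (f p) by exact: chart_at_dom.
  have oB : open (A `&` f @^-1` cdom c).
    by apply: openI => //; apply: preimage_open => //; exact: cdom_open.
  exists (A `&` f @^-1` cdom c); split=> //.
  apply: (smooth_on_eq (g := fun q => \sum_(j < n) (tder c (f q) (s q) 0 j
     * (((fun x => 'd (h \o cinv c : _ -> R^o) x (delta_mx 0 j)) \o c) \o f) q) : R^o)) => //.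
    move=> q [Aq cq].
    rewrite /dfun (tder_chart (s q) cA cq I sh).
    exact: (esym (linear_rowE ('d (h \o cinv c : _ -> R^o) (c (f q))) _)).
  apply: smooth_on_sum => // j; apply: smooth_onM => //.
    exact: (smooth_on_row _ oB).1 (ss c cA) j.
  apply: smooth_on_sub (fun q => @proj2 _ _) _.
  apply: (smooth_map_comp sf (@cdom_open _ _ _ c)).
  apply: chart_dom_smooth => // k.
  have := sh c cA k.+1; rewrite setIT => -[_]; exact.
have oB : open (A `&` f @^-1` cdom c).
  by apply: openI => //; apply: preimage_open => //; exact: cdom_open.
apply: smooth_on_local => p [Ap cp].
have sc j := coord_smooth j cA.
exists (A `&` f @^-1` cdom c); split=> //; apply/smooth_on_row => // j.
apply: smooth_on_local => q [Aq cq].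
have [kap skap kapE] := extend_fun (@cdom_open _ _ _ c) cq (sc j).
have [U [oU Uq HU]] := near_open kapE.
have oV : open (A `&` f @^-1` (cdom c `&` U)).
  apply: openI => //; apply: preimage_open => //.
  by apply: openI => //; exact: cdom_open.
exists (A `&` f @^-1` (cdom c `&` U)); split=> //.
apply: (smooth_on_eq (g := fun q => dfun kap (f q) (s q))) => //; last first.
  by apply: smooth_on_sub (H kap skap) => ? [].
move=> q' [Aq' [cq' Uq']].
rewrite (tder_coord (s q') j cq' (A := cdom c)); last first.
  move=> d dA k; exact: atlas_compatible.
apply/esym/(dfun_near (A := setT)) => //.
exact: filterS HU (open_near oU Uq').
Qed.

End Sections.

(** * Local frames *)

Section Frames.
Context {R : realType} {m : nat} {M : manifold R m}.
Implicit Types (c d : chart R m M) (A B : set M) (p q : M).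

(** The tangent vector with components w in the chart c. *)
Definition chart_vec c q (w : 'rV[R]_m) : 'rV[R]_m :=
  'd (chart_at q \o cinv c) (c q) w.

Lemma atlas_smooth_on c : atlas c -> smooth_on (cdom c) c.
Proof. by move=> cA d dA k; exact: atlas_compatible. Qed.

Lemma dfun_chart_vec c A (h : M -> R) q w : atlas c -> cdom c q -> A q ->
  smooth_on A (h : M -> R^o) ->
  dfun h q (chart_vec c q w) = 'd (h \o cinv c : _ -> R^o) (c q) w.
Proof.
move=> cA cq Aq sh; apply: esym; apply: diff_transition Aq sh => //.
  exact: chart_at_atlas.
exact: chart_at_dom.
Qed.

Lemma chart_vecK c q v : atlas c -> cdom c q -> chart_vec c q (tder c q v) = v.
Proof.
move=> cA cq; rewrite /chart_vec.
have dq : cdom (chart_at q) q by exact: chart_at_dom.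
have dA := chart_at_atlas q.
rewrite -(tder_chart v cA cq dq (atlas_smooth_on dA)) /tder.
have E : \forall x \near chart_at q q, id x = (chart_at q \o cinv (chart_at q)) x.
  have := chart_img_near dq; apply: filterS => _ [q' dq' <-] /=.
  by rewrite cfunK.
have di : is_diff (chart_at q q) id id := is_diff_id (chart_at q q).
have [_ E'] := diff_near E (@ex_diff _ _ _ _ _ _ _ di).
by apply: etrans (congr1 (@^~ v) E') _; rewrite diff_val.
Qed.

(** Coordinate functions and coordinate fields of a chart, cut off so as to be
    global, and dual to each other near p. *)
Lemma local_frame p : exists (kap : 'I_m -> M -> R) (E : 'I_m -> M -> 'rV[R]_m) (A : set M),
  [/\ open A, A p, (forall j, smooth_fun (kap j)), (forall i, smooth_vfield (E i))
    & forall q, A q -> (forall i j, dfun (kap j) q (E i q) = (i == j)%:R) /\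
       (forall v, v = \sum_j dfun (kap j) q v *: E j q)].
Proof.
pose c := chart_at p.
have cA : atlas c := chart_at_atlas p.
have cp : cdom c p := chart_at_dom p.
have oc := @cdom_open _ _ _ c.
have [kap kapP] : exists kap : 'I_m -> M -> R, forall j,
    smooth_fun (kap j) /\ (\forall q \near p, kap j q = c q 0 j).
  have H j := extend_fun oc cp (coord_smooth j cA).
  exists (fun j => sval (cid2 (H j))) => j; case: (cid2 (H j)) => k /=; done.
have [chi [B [schi chi1 oB AB chi0]]] := cutoff oc cp.
pose E i q : 'rV[R]_m := chi q *: chart_vec c q (delta_mx 0 i).
have N : \forall q \near p, [/\ cdom c q, chi q = 1 & forall j, kap j q = c q 0 j].
  have N1 : \forall q \near p, forall j, kap j q = c q 0 j.
    by apply: filter_forall => j; have [] := kapP j.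
  have N0 := open_near oc cp.
  by apply: filterS3 N0 chi1 N1 => q.
have [A [oA Ap HA]] := near_open N.
have kapE q v : A q -> forall j, dfun (kap j) q v = tder c q v 0 j.
  move=> Aq j; have [cq _ _] := HA q Aq.
  rewrite (tder_coord v j cq (atlas_smooth_on cA)).
  apply: (dfun_near _ cq (coord_smooth j cA)).
  by apply: filterS (open_near oA Aq) => q' /HA [_ _ ->].
exists kap, E, A; split=> //.
- by move=> j; have [] := kapP j.
- move=> i; apply/(smooth_sectionP _ (smooth_idfun M) openT) => h sh.
  apply: (smooth_on_eq (g := fun q => chi q *
     ((fun x => 'd (h \o cinv c : _ -> R^o) x (delta_mx 0 i)) (c q)) : R^o)).
  + exact: openT.
  + move=> q _; rewrite /E dfunZr; have [cq|/chi0 ->] := AB q; last by rewrite !mul0r.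
    by rewrite (dfun_chart_vec _ cA cq I sh).
  apply: cutoff_smooth AB chi0 schi _ => //.
  apply: (chart_dom_smooth (g := fun x => 'd (h \o cinv c : _ -> R^o) x (delta_mx 0 i))) => // k.
  have := sh c cA k.+1; rewrite setIT => -[_]; exact.
move=> q Aq; have [cq chiq _] := HA q Aq; split=> [i j|v].
  rewrite kapE//; have := tder_coord (E i q) j cq (atlas_smooth_on cA); move=> ->.
  rewrite /E chiq scale1r (dfun_chart_vec _ cA cq cq (coord_smooth j cA)).
  have : \forall x \near c q, (x : 'rV[R]_m) 0 j = ((fun q => c q 0 j) \o cinv c) x.
    have := chart_img_near cq; apply: filterS => _ [q' dq' <-] /=.
    by rewrite cfunK.
  have glin : linear (fun u : 'rV[R]_m => u 0 j : R^o).
    by move=> a u w; rewrite !mxE.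
  pose glM := GRing.isLinear.Build _ _ _ _ _ glin.
  pose gL : {linear _ -> _} := HB.pack (fun u : 'rV[R]_m => u 0 j : R^o) glM.
  have cL : continuous gL by exact: coord_continuous.
  move=> near_id.
  have [_ E'] := diff_near (f := gL) near_id (linear_differentiable (c q) cL).
  apply: etrans (congr1 (@^~ _) E') _.
  apply: etrans (congr1 (@^~ _) (diff_lin (c q) cL)) _ => /=.
  by rewrite mxE eqxx eq_sym.
rewrite -{1}(chart_vecK v cA cq) /chart_vec {1}(row_sum_delta (tder c q v)) linear_sum.
apply: eq_bigr => j _; rewrite linearZ /E chiq scale1r kapE//.
Qed.

Lemma vec_eq0 p (v : 'rV[R]_m) :
  (forall h : M -> R, smooth_fun h -> dfun h p v = 0) -> v = 0.
Proof.
have [kap [E [A [oA Ap skap sE /(_ p Ap) [_ H]]]]] := local_frame p.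
by move=> v0; rewrite (H v) big1// => j _; rewrite v0// scale0r.
Qed.

End Frames.

Section SectionAlgebra.
Context {R : realType} {m n : nat} {M : manifold R m} {N : manifold R n}.
Variable f : M -> N.
Hypothesis sf : smooth_map f.
Implicit Types (s t : M -> 'rV[R]_n) (A : set M).

Lemma section_D A s t : open A -> smooth_section_on f A s -> smooth_section_on f A t ->
  smooth_section_on f A (fun q => s q + t q).
Proof.
move=> oA /(smooth_sectionP _ sf oA) ss /(smooth_sectionP _ sf oA) st.
apply/(smooth_sectionP _ sf oA) => h sh.
apply: smooth_on_eq oA _ (smooth_onD oA (ss h sh) (st h sh)) => q _.
by rewrite dfunDr.
Qed.

Lemma section_Z A (a : M -> R) s : open A -> smooth_on A (a : M -> R^o) ->
  smooth_section_on f A s -> smooth_section_on f A (fun q => a q *: s q).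
Proof.
move=> oA sa /(smooth_sectionP _ sf oA) ss.
apply/(smooth_sectionP _ sf oA) => h sh.
apply: smooth_on_eq oA _ (smooth_onM oA sa (ss h sh)) => q _.
by rewrite dfunZr.
Qed.

Lemma section_0 A : open A -> smooth_section_on f A (fun=> 0).
Proof.
move=> oA; apply/(smooth_sectionP _ sf oA) => h sh.
apply: smooth_on_eq oA _ (smooth_on_cst A (0 : R^o)) => q _.
by rewrite dfun0r.
Qed.

Lemma section_sum A I (r : seq I) (F : I -> M -> 'rV[R]_n) : open A ->
  (forall i, smooth_section_on f A (F i)) ->
  smooth_section_on f A (fun q => \sum_(i <- r) F i q).
Proof.
move=> oA sF; elim: r => [|i r IH].
  rewrite (_ : (fun q => _) = fun=> 0); first exact: section_0.
  by apply/funext => q; rewrite big_nil.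
rewrite (_ : (fun q => _) = fun q => F i q + \sum_(j <- r) F j q).
  exact: section_D.
by apply/funext => q; rewrite big_cons.
Qed.

Lemma section_local s :
  (forall p, exists A, [/\ open A, A p & smooth_section_on f A s]) -> smooth_section f s.
Proof.
move=> H; apply/(smooth_sectionP _ sf openT) => h sh.
apply: smooth_on_local => p _; have [A [oA Ap sA]] := H p.
by exists A; split=> //; exact: (smooth_sectionP _ sf oA).1 sA h sh.
Qed.

Lemma section_eq A s t : open A -> (forall q, A q -> s q = t q) ->
  smooth_section_on f A s -> smooth_section_on f A t.
Proof.
move=> oA st /(smooth_sectionP _ sf oA) ss.
apply/(smooth_sectionP _ sf oA) => h sh.
by apply: smooth_on_eq oA _ (ss h sh) => q Aq; rewrite st.
Qed.

Lemma section_sub A s : open A -> smooth_section f s -> smooth_section_on f A s.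
Proof.
move=> oA /(smooth_sectionP _ sf openT) ss.
apply/(smooth_sectionP _ sf oA) => h sh.
exact: smooth_on_sub (ss h sh).
Qed.

Lemma section_comp (Y : N -> 'rV[R]_n) : smooth_vfield Y -> smooth_section f (Y \o f).
Proof.
move=> /(smooth_sectionP _ (smooth_idfun N) openT) sY.
apply/(smooth_sectionP _ sf openT) => h sh.
exact: (smooth_map_comp sf openT (sY h sh)).
Qed.

Lemma section_tmap (X : M -> 'rV[R]_m) : smooth_vfield X -> smooth_section f (tapp (tmap f) X).
Proof.
move=> /(smooth_sectionP _ (smooth_idfun M) openT) sX.
apply/(smooth_sectionP _ sf openT) => h sh.
apply: smooth_on_eq openT _ (sX (h \o f) (smooth_map_comp sf openT sh)) => q _.
by rewrite (dfun_comp _ sf openT I sh).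
Qed.

End SectionAlgebra.

Section Fields.
Context {R : realType} {m : nat} {M : manifold R m}.

Lemma dfun_smooth A (h : M -> R) X : open A -> smooth_fun h -> smooth_vfield_on A X ->
  smooth_on A (fun q => dfun h q (X q) : R^o).
Proof. by move=> oA sh /(smooth_sectionP _ (smooth_idfun M) oA); apply. Qed.

Lemma extend_vec p (v : 'rV[R]_m) : exists2 X : M -> 'rV[R]_m, smooth_vfield X & X p = v.
Proof.
have [kap [E [A [oA Ap skap sE /(_ p Ap) [_ H]]]]] := local_frame p.
exists (fun q => \sum_j dfun (kap j) p v *: E j q); last by rewrite -H.
apply: section_sum; [exact: smooth_idfun|exact: openT|] => j.
apply: section_Z (sE j); [exact: smooth_idfun|exact: openT|exact: smooth_on_cst].
Qed.
End Fields.

(** * Metrics, gradients and orthogonal projections *)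

Section InnerProduct.
Context {R : realType} {m : nat}.
Implicit Types (G : 'M[R]_m) (u v w : 'rV[R]_m).

Lemma ipDl G u v w : ip G (u + v) w = ip G u w + ip G v w.
Proof. by rewrite /ip !mulmxDl mxE. Qed.
Lemma ipDr G u v w : ip G u (v + w) = ip G u v + ip G u w.
Proof. by rewrite /ip linearD mulmxDr mxE. Qed.
Lemma ipZl G a u v : ip G (a *: u) v = a * ip G u v.
Proof. by rewrite /ip -!scalemxAl mxE. Qed.
Lemma ipZr G a u v : ip G u (a *: v) = a * ip G u v.
Proof. by rewrite /ip linearZ -scalemxAr mxE. Qed.
Lemma ipNl G u v : ip G (- u) v = - ip G u v.
Proof. by rewrite -scaleN1r ipZl mulN1r. Qed.
Lemma ipNr G u v : ip G u (- v) = - ip G u v.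
Proof. by rewrite -scaleN1r ipZr mulN1r. Qed.
Lemma ip0l G u : ip G 0 u = 0.
Proof. by rewrite /ip !mul0mx mxE. Qed.
Lemma ip0r G u : ip G u 0 = 0.
Proof. by rewrite /ip trmx0 mulmx0 mxE. Qed.
Lemma ip_suml I (r : seq I) G (F : I -> 'rV[R]_m) v :
  ip G (\sum_(i <- r) F i) v = \sum_(i <- r) ip G (F i) v.
Proof.
by elim: r => [|i r IH]; rewrite ?big_nil ?ip0l// !big_cons ipDl IH.
Qed.

Definition ipE := (ipDl, ipDr, ipNl, ipNr, ipZl, ipZr, ip0l, ip0r).

Lemma orthP k G (D : 'M[R]_(k, m)) v :
  reflect (forall u, (u <= D)%MS -> ip G v u = 0) (v <= orth G D)%MS.
Proof.
rewrite /orth sub_kermx; apply: (iffP eqP) => [H u /submxP[x ->]|H].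
  by rewrite /ip trmx_mul mulmxA -[v *m G *m _]mulmxA H mul0mx mxE.
apply/rowP => j; have := H (row j D) (row_sub _ _).
by rewrite /ip tr_row colE mulmxA -[v *m G *m _]mulmxA -colE mxE => ->; rewrite mxE.
Qed.

Definition posdef G := (forall u v, ip G u v = ip G v u) /\
  (forall u, u != 0 -> 0 < ip G u u).

Section Posdef.
Variable (G : 'M[R]_m).
Hypothesis HG : posdef G.

Lemma ipC u v : ip G u v = ip G v u.
Proof. exact: HG.1. Qed.

Lemma ip_eq0 u : ip G u u = 0 -> u = 0.
Proof. by move=> H; apply/eqP; apply/negP => /negP /HG.2; rewrite H ltxx. Qed.

Lemma ip_ext u : (forall v, ip G u v = 0) -> u = 0.
Proof. by move=> H; exact: ip_eq0. Qed.

Lemma posdef_unit : G \in unitmx.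
Proof.
rewrite -row_free_unit; apply: inj_row_free => v vG; apply: ip_eq0.
by rewrite /ip vG mul0mx mxE.
Qed.

Lemma orth_cap (D : 'M[R]_m) u : (u <= D)%MS -> (u <= orth G D)%MS -> u = 0.
Proof. by move=> uD /orthP /(_ u uD) /ip_eq0. Qed.

Lemma orth_cap0 (D : 'M[R]_m) : (D :&: orth G D)%MS = 0.
Proof.
apply/eqP; rewrite -submx0; apply/row_subP => i.
have := row_sub i (D :&: orth G D)%MS; rewrite sub_capmx => /andP[h1 h2].
by rewrite (orth_cap h1 h2) sub0mx.
Qed.

(** A subspace and its orthogonal fill the space by a dimension count. *)
Lemma orth_full (D : 'M[R]_m) v : (v <= D + orth G D)%MS.
Proof.
apply: submx_full; rewrite /row_full eqn_leq rank_leq_col /=.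
rewrite mxrank_disjoint_sum ?orth_cap0// /orth mxrank_ker.
by rewrite -leq_subLR leq_sub2l// -(mxrank_tr D) mxrankM_maxr.
Qed.

Lemma oproj_sub (D : 'M[R]_m) v : (v *m oproj G D <= D)%MS.
Proof. exact: proj_mx_sub. Qed.

Lemma oproj_compl (D : 'M[R]_m) v : (v - v *m oproj G D <= orth G D)%MS.
Proof. exact/proj_mx_compl_sub/orth_full. Qed.

Lemma oproj_unique (D : 'M[R]_m) v u :
  (u <= D)%MS -> (v - u <= orth G D)%MS -> v *m oproj G D = u.
Proof.
move=> uD vu; apply: subr0_eq; apply: (orth_cap (D := D)).
  by rewrite addmx_sub ?oproj_sub// eqmx_opp.
have -> : v *m oproj G D - u = (v - u) - (v - v *m oproj G D).
  by rewrite opprB [RHS]addrC addrA subrK.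
by rewrite addmx_sub// eqmx_opp oproj_compl.
Qed.

Lemma orthK (D : 'M[R]_m) v : (v <= orth G (orth G D))%MS = (v <= D)%MS.
Proof.
apply/idP/idP => [H|vD]; last first.
  by apply/orthP => u /orthP H; rewrite ipC; exact: H.
have := oproj_compl D v; set u := v *m _ => vu.
have uD : (u <= D)%MS by exact: oproj_sub.
suff /subr0_eq -> : v - u = 0 by [].
apply: (orth_cap vu).
rewrite addmx_sub// eqmx_opp; apply/orthP => w /orthP Hw.
by rewrite ipC; exact: Hw.
Qed.

Lemma oproj_orth (D : 'M[R]_m) v : v *m oproj G (orth G D) = v - v *m oproj G D.
Proof.
apply: oproj_unique; first exact: oproj_compl.
by rewrite opprB addrC subrK orthK oproj_sub.
Qed.

Lemma oproj_eqmx (D D' : 'M[R]_m) v : (D :=: D')%MS -> v *m oproj G D = v *m oproj G D'.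
Proof.
move=> DD'; apply: oproj_unique; first by rewrite DD' oproj_sub.
by apply/orthP => u uD; have /orthP := oproj_compl D' v; apply; rewrite -DD'.
Qed.

End Posdef.
End InnerProduct.

Section SmoothMatrix.
Context {R : realType} {m : nat} {M : manifold R m}.

Lemma det_smooth A k (B : M -> 'M[R]_k) : open A ->
  (forall i j, smooth_on A (fun q => B q i j : R^o)) ->
  smooth_on A (fun q => \det (B q) : R^o).
Proof.
move=> oA sB; apply: smooth_on_sum => // s.
have sP : smooth_on A (fun q => \prod_i B q i (s i) : R^o).
  by apply: smooth_on_prod => // i; exact: sB.
exact: (smooth_onM oA (smooth_on_cst A ((-1) ^+ s : R^o)) sP).
Qed.

(** Cramer's rule. *)
Lemma invmx_smooth A k (B : M -> 'M[R]_k) i j : open A ->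
  (forall i j, smooth_on A (fun q => B q i j : R^o)) ->
  (forall q, A q -> B q \in unitmx) ->
  smooth_on A (fun q => invmx (B q) i j : R^o).
Proof.
move=> oA sB uB.
apply: (smooth_on_eq (g := fun q => (\det (B q))^-1 * cofactor (B q) j i : R^o)) => //.
  by move=> q Aq; rewrite /invmx (uB q Aq) !mxE.
apply: smooth_onM => //; first apply: smooth_onV => //.
- by move=> q Aq; have := uB q Aq; rewrite unitmxE unitfE.
- exact: det_smooth.
have sM : smooth_on A (fun q => \det (row' j (col' i (B q))) : R^o).
  apply: det_smooth => // a b.
  by apply: smooth_on_eq (sB (lift j a) (lift i b)) => // q _; rewrite !mxE.
exact: (smooth_onM oA (smooth_on_cst A ((-1) ^+ (j + i) : R^o)) sM).
Qed.
End SmoothMatrix.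

Section Metric.
Context {R : realType} {m : nat} {M : manifold R m}.
Variable g : M -> 'M[R]_m.
Hypothesis rg : riemannian_metric g.

Lemma metric_posdef p : posdef (g p).
Proof. by case: rg => sg pg _; split=> [u v|u]; [exact: sg|exact: pg]. Qed.

Lemma metric_smooth A X Y : open A -> smooth_vfield_on A X -> smooth_vfield_on A Y ->
  smooth_on A (fun q => ip (g q) (X q) (Y q) : R^o).
Proof. by case: rg => _ _; apply. Qed.

(** Over a neighbourhood on which fields Y_j stay independent, the combination
    of the Y_j with prescribed smooth inner products against the Y_l is
    smooth, its coefficients being given by the inverse Gram matrix. *)
Lemma gram_solve A k (Y : 'I_k -> M -> 'rV[R]_m) (a : 'I_k -> M -> R) : open A ->
  (forall j, smooth_vfield_on A (Y j)) -> (forall j, smooth_on A (a j : M -> R^o)) ->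
  (forall q, A q -> forall c : 'I_k -> R, \sum_j c j *: Y j q = 0 -> forall j, c j = 0) ->
  exists Z, [/\ smooth_vfield_on A Z,
     forall q, exists c : 'I_k -> R, Z q = \sum_j c j *: Y j q
   & forall q, A q -> forall l, ip (g q) (Z q) (Y l q) = a l q].
Proof.
move=> oA sY sa indep.
pose B q : 'M[R]_k := \matrix_(j, l) ip (g q) (Y j q) (Y l q).
pose av q : 'rV[R]_k := \row_l a l q.
pose c q : 'rV[R]_k := av q *m invmx (B q).
have ipB q (x : 'rV[R]_k) l :
    ip (g q) (\sum_j x 0 j *: Y j q) (Y l q) = (x *m B q) 0 l.
  by rewrite ip_suml mxE; apply: eq_bigr => j _; rewrite ipZl !mxE.
have uB q : A q -> B q \in unitmx.
  move=> Aq; rewrite -row_free_unit; apply: inj_row_free => x xB.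
  apply/rowP => j; rewrite mxE; apply: (indep q Aq (fun j => x 0 j)).
  apply: (ip_eq0 (metric_posdef q)).
  have ip0 l : ip (g q) (\sum_j x 0 j *: Y j q) (Y l q) = 0 by rewrite ipB xB mxE.
  rewrite ip_suml big1// => l _.
  by rewrite ipZl (ipC (metric_posdef q)) ip0 mulr0.
have sB i j : smooth_on A (fun q => B q i j : R^o).
  by apply: smooth_on_eq (metric_smooth oA (sY i) (sY j)) => // q _; rewrite mxE.
exists (fun q => \sum_j c q 0 j *: Y j q); split.
- apply: section_sum => //; first exact: smooth_idfun.
  move=> j; apply: section_Z (sY j) => //; first exact: smooth_idfun.
  apply: (smooth_on_eq (g := fun q => \sum_l a l q * invmx (B q) l j : R^o)) => //.
    by move=> q _; rewrite /c mxE; apply: eq_bigr => l _; rewrite mxE.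
  apply: smooth_on_sum => // l; apply: smooth_onM => //.
  exact: invmx_smooth.
- by move=> q; exists (fun j => c q 0 j).
- by move=> q Aq l; rewrite ipB /c mulmxKV ?uB// mxE.
Qed.

Lemma grad_ip h p v : ip (g p) (grad g h p) v = dfun h p v.
Proof.
rewrite /ip /grad mulmxKV ?(posdef_unit (metric_posdef p))// mxE.
rewrite [in RHS](row_sum_delta v) dfun_sumr.
by apply: eq_bigr => i _; rewrite dfunZr !mxE mulrC.
Qed.

(** In a frame E the gradient is the field whose inner products with the E_l are
    the derivatives of h along E_l, so that [gram_solve] applies. *)
Lemma grad_smooth (h : M -> R) : smooth_fun h -> smooth_vfield (grad g h).
Proof.
move=> sh; apply: section_local => [|p]; first exact: smooth_idfun.
have [kap [E [A [oA Ap skap sE HA]]]] := local_frame p.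
have sEA j : smooth_vfield_on A (E j) by exact: (section_sub (smooth_idfun M) oA (sE j)).
have [|Z [sZ _ HZ]] := gram_solve oA sEA (fun j => dfun_smooth oA sh (sEA j)).
  move=> q Aq c c0 j; have [dk _] := HA q Aq.
  have : dfun (kap j) q (\sum_j c j *: E j q) = 0 by rewrite c0 dfun0r.
  rewrite dfun_sumr (bigD1 j)//= dfunZr dk eqxx mulr1 big1 ?addr0// => i ij.
  by rewrite dfunZr dk (negPf ij) mulr0.
exists A; split=> //; apply: section_eq sZ => //; first exact: smooth_idfun.
move=> q Aq; apply: subr0_eq; apply: (ip_ext (metric_posdef q)) => v.
have [_ /(_ v) ->] := HA q Aq.
rewrite (ipC (metric_posdef q)) ip_suml big1// => j _.
rewrite ipZl (ipC (metric_posdef q)) ipDl ipNl HZ// grad_ip subrr mulr0//.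
Qed.

End Metric.

Section Projection.
Context {R : realType} {m n : nat} {M : manifold R m} {N : manifold R n}.
Variables (g : M -> 'M[R]_m) (Psi : M -> N).
Hypotheses (rg : riemannian_metric g) (sPsi : smooth_map Psi).
Hypothesis fullPsi : forall p, row_full (tmap Psi p).

(** The gradients of the coordinates of the target pulled back by Psi span the
    horizontal spaces locally, and the horizontal part of X has the same inner
    products with them as X, namely the derivatives along X. *)
Lemma hproj_smooth X : smooth_vfield X -> smooth_vfield (tapp (hproj g Psi) X).
Proof.
move=> sX; apply: section_local => [|p]; first exact: smooth_idfun.
have [kap [E [A0 [oA0 Ap skap _ HA0]]]] := local_frame (Psi p).
pose A := Psi @^-1` A0.
have oA : open A by exact: preimage_open.
pose h j := kap j \o Psi.
have sh j : smooth_fun (h j) by exact: (smooth_map_comp sPsi openT (skap j)).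
have dh j q v : dfun (h j) q v = dfun (kap j) (Psi q) (v *m tmap Psi q).
  exact: dfun_comp sPsi openT I (skap j).
have gip j q v : ip (g q) (grad g (h j) q) v = dfun (kap j) (Psi q) (v *m tmap Psi q).
  by rewrite (grad_ip rg) dh.
have sY j : smooth_vfield_on A (grad g (h j)).
  exact: (section_sub (smooth_idfun M) oA (grad_smooth rg (sh j))).
have sXA : smooth_vfield_on A X by exact: (section_sub (smooth_idfun M) oA sX).
have [|Z [sZ spanZ HZ]] := gram_solve rg oA sY (fun j => dfun_smooth oA (sh j) sXA).
  move=> q Aq c c0 i; have [dk _] := HA0 _ Aq.
  have /row_fullP[B BJ] := fullPsi q.
  have gE j : ip (g q) (grad g (h j) q) (E i (Psi q) *m B) = (i == j)%:R.
    by rewrite gip -mulmxA BJ mulmx1 dk.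
  have : ip (g q) (\sum_j c j *: grad g (h j) q) (E i (Psi q) *m B) = 0.
    by rewrite c0 ip0l.
  rewrite ip_suml (eq_bigr (fun j => c j * (i == j)%:R)); last first.
    by move=> j _; rewrite ipZl gE.
  rewrite (bigD1 i)//= eqxx mulr1 big1 ?addr0// => j ij.
  by rewrite eq_sym (negPf ij) mulr0.
exists A; split=> //; apply: section_eq sZ => //; first exact: smooth_idfun.
move=> q Aq; apply/esym; apply: oproj_unique; first exact: metric_posdef.
  apply/orthP => u; rewrite /ver sub_kermx => /eqP uJ.
  have [c ->] := spanZ q; rewrite ip_suml big1// => j _.
  by rewrite ipZl gip uJ dfun0r mulr0.
rewrite orthK; last exact: metric_posdef.
rewrite /ver sub_kermx; apply/eqP.
apply: etrans ((HA0 _ Aq).2 _) _; rewrite big1// => j _.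
rewrite -gip (ipC (metric_posdef rg q)) ipDl ipNl HZ//.
by rewrite (ipC (metric_posdef rg q)) gip dh subrr scale0r.
Qed.

Lemma vproj_smooth X : smooth_vfield X -> smooth_vfield (tapp (vproj g Psi) X).
Proof.
move=> sX; rewrite (_ : tapp _ _ = fun q => X q + -1 *: tapp (hproj g Psi) X q).
  apply: section_D => //; [exact: smooth_idfun|exact: openT|].
  apply: section_Z; [exact: smooth_idfun|exact: openT|exact: smooth_on_cst|].
  exact: hproj_smooth.
apply/funext => q; rewrite scaleN1r /tapp /hproj /hor oproj_orth; last exact: metric_posdef.
by rewrite opprB addrC subrK.
Qed.
End Projection.

(** * Connections along a map *)

Section LocalFrame.
Context {R : realType} {m : nat} {M : manifold R m}.

(** Multiplying by chi makes the expansion in the frame valid everywhere, so that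
    the Leibniz rule, which is stated for global fields, applies to it. *)
Lemma cutoff_frame (p : M) : exists (kap : 'I_m -> M -> R) (E : 'I_m -> M -> 'rV[R]_m) (chi : M -> R) (V : set M),
  [/\ (forall j, smooth_fun (kap j)), (forall i, smooth_vfield (E i)), smooth_fun chi,
    (forall q v, chi q *: v = \sum_j dfun (kap j) q v *: E j q)
    & [/\ open V, V p, (forall q, V q -> chi q = 1) &
       forall q, V q -> forall i j, dfun (kap j) q (E i q) = (i == j)%:R]].
Proof.
have [kap [E [A [oA Ap skap sE HA]]]] := local_frame p.
have [chi [B [schi chi1 oB AB chi0]]] := cutoff oA Ap.
have [V [oV Vp HV]] := near_open (filterI (open_near oA Ap) chi1).
exists kap, (fun j q => chi q *: E j q), chi, V; split=> //.
- by move=> i; exact: (section_Z (smooth_idfun M) openT schi (sE i)).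
- move=> q v; have [Aq|/chi0 c0] := AB q.
    rewrite {1}((HA q Aq).2 v) scaler_sumr; apply: eq_bigr => j _.
    by rewrite scalerA mulrC -scalerA.
  by rewrite c0 scale0r big1// => j _; rewrite scale0r scaler0.
split=> // q /HV [] // Aq c1 i j.
by rewrite c1 scale1r (HA q Aq).1.
Qed.
End LocalFrame.

Section ConnectionTheory.
Context {R : realType} {m n : nat} {M : manifold R m} {N : manifold R n}.
Variables (f : M -> N) (D : (M -> 'rV[R]_m) -> (M -> 'rV[R]_n) -> M -> 'rV[R]_n).
Hypotheses (sf : smooth_map f) (cD : connection f D).

Lemma conn_smooth X s : smooth_vfield X -> smooth_section f s -> smooth_section f (D X s).
Proof. by case: cD => H *; exact: H. Qed.

Lemma connDl X Y s p : smooth_vfield X -> smooth_vfield Y -> smooth_section f s ->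
  D (fun q => X q + Y q) s p = D X s p + D Y s p.
Proof. by case: cD => _ H *; exact: H. Qed.

Lemma connZl h X s p : smooth_fun h -> smooth_vfield X -> smooth_section f s ->
  D (fun q => h q *: X q) s p = h p *: D X s p.
Proof. by case: cD => _ _ H *; exact: H. Qed.

Lemma connDr X s t p : smooth_vfield X -> smooth_section f s -> smooth_section f t ->
  D X (fun q => s q + t q) p = D X s p + D X t p.
Proof. by case: cD => _ _ _ H *; exact: H. Qed.

Lemma connZr h X s p : smooth_fun h -> smooth_vfield X -> smooth_section f s ->
  D X (fun q => h q *: s q) p = h p *: D X s p + dfun h p (X p) *: s p.
Proof. by case: cD => _ _ _ _ H *; exact: H. Qed.

Lemma conn0r X p : smooth_vfield X -> D X (fun=> 0) p = 0.
Proof.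
move=> sX; have s0 : smooth_section f (fun=> 0) := section_0 sf openT.
have := @connZr (fun=> 0) X (fun=> 0) p (smooth_on_cst _ (0 : R^o)) sX s0.
rewrite (_ : (fun q => 0 *: 0) = fun=> 0); last by apply/funext => q; rewrite scaler0.
by rewrite scale0r scaler0 addr0.
Qed.

Lemma conn_sumr X k (F : 'I_k -> M -> 'rV[R]_n) p : smooth_vfield X ->
  (forall i, smooth_section f (F i)) ->
  D X (fun q => \sum_i F i q) p = \sum_i D X (F i) p.
Proof.
move=> sX sF.
suff H r : D X (fun q => \sum_(i <- r) F i q) p = \sum_(i <- r) D X (F i) p by exact: H.
elim: r => [|i r IH].
  rewrite big_nil (_ : (fun q => _) = fun=> 0) ?conn0r//.
  by apply/funext => q; rewrite big_nil.
rewrite big_cons -IH -connDr//; last by apply: section_sum => //; exact: openT.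
congr (D X _ p); by apply/funext => q; rewrite big_cons.
Qed.

(** The Leibniz rule applied to the global expansion of chi s; the derivative of
    chi vanishes at p, chi being 1 near f p. *)
Lemma conn_expand X s p kap E chi V : smooth_vfield X -> smooth_section f s ->
  (forall j, smooth_fun (kap j)) -> (forall i, smooth_vfield (E i)) -> smooth_fun chi ->
  (forall q v, chi q *: v = \sum_(j < n) dfun (kap j) q v *: E j q) ->
  open V -> V (f p) -> (forall q : N, V q -> chi q = 1) ->
  D X s p = \sum_j (dfun (kap j) (f p) (s p) *: D X (E j \o f) p
     + dfun (fun q => dfun (kap j) (f q) (s q)) p (X p) *: E j (f p)).
Proof.
move=> sX ss skap sE schi HE oV Vp chi1.
have sc : smooth_fun (chi \o f) by exact: (smooth_map_comp sf openT schi).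
have ssig j : smooth_fun (fun q => dfun (kap j) (f q) (s q)).
  exact: (smooth_sectionP _ sf openT).1 ss _ (skap j).
have E1 := connZr p sc sX ss.
have dc : dfun (chi \o f) p (X p) = 0.
  rewrite -(dfun_cst 1 p (X p)).
  apply: (@dfun_near _ _ _ setT) => //; first exact: (smooth_on_cst setT (1 : R^o)).
  have oU : open (f @^-1` V) by exact: preimage_open.
  by apply: filterS (open_near oU Vp) => q /chi1 /= ->.
move: E1; rewrite dc scale0r addr0 /= chi1// scale1r => <-.
rewrite (_ : (fun q => chi (f q) *: s q) =
   fun q => \sum_j dfun (kap j) (f q) (s q) *: (E j \o f) q); last first.
  by apply/funext => q; rewrite HE.
rewrite conn_sumr//.
  apply: eq_bigr => j _; rewrite connZr//; exact: section_comp.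
by move=> i; exact: (section_Z sf openT (ssig i) (section_comp sf (sE i))).
Qed.

End ConnectionTheory.

Section PullbackConnection.
Context {R : realType} {m n : nat} {M : manifold R m} {N : manifold R n}.
Variables (f : M -> N) (gN : N -> 'M[R]_n).
Variables (nM : (M -> 'rV[R]_m) -> (M -> 'rV[R]_m) -> M -> 'rV[R]_m).
Variables (gM : M -> 'M[R]_m).
Variables (nN : (N -> 'rV[R]_n) -> (N -> 'rV[R]_n) -> N -> 'rV[R]_n).
Variables (D : (M -> 'rV[R]_m) -> (M -> 'rV[R]_n) -> M -> 'rV[R]_n).
Hypotheses (sf : smooth_map f) (rgN : riemannian_metric gN).
Hypotheses (lcM : levi_civita gM nM) (lcN : levi_civita gN nN) (pD : pullback_connection f nN D).

Let cD : connection f D. Proof. by case: pD. Qed.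

Lemma pullback_comp X V Y p : smooth_vfield X -> smooth_vfield V -> smooth_vfield Y ->
  X p *m tmap f p = V (f p) -> D X (Y \o f) p = nN V Y (f p).
Proof. by case: pD => _ H *; exact: H. Qed.

(** Expand Psi_* X and Psi_* Y in a frame E pulled back from the target. The
    derivatives of the coefficients give the image of the bracket of X and Y.
    The remaining terms are the bracket on the target of two combinations of
    the E_j with constant coefficients, which vanishes since the E_j are
    coordinate fields near the point. *)
Lemma pullback_torsion X Y p : smooth_vfield X -> smooth_vfield Y ->
  D X (tapp (tmap f) Y) p - D Y (tapp (tmap f) X) p
  = (nM X Y p - nM Y X p) *m tmap f p.
Proof.
move=> sX sY.
have [kap [E [chi [V [skap sE schi HE [oV Vp chi1 dual]]]]]] := cutoff_frame (f p).
have vE v : v = \sum_j dfun (kap j) (f p) v *: E j (f p).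
  by rewrite -HE chi1// scale1r.
have expand Z s : smooth_vfield Z -> smooth_section f s -> D Z s p = _ :=
  fun sZ ss => conn_expand sf cD sZ ss skap sE schi HE oV Vp chi1.
have sfX := section_tmap sf sX; have sfY := section_tmap sf sY.
pose x j := dfun (kap j) (f p) (X p *m tmap f p).
pose y j := dfun (kap j) (f p) (Y p *m tmap f p).
pose cf (z : 'I_n -> R) (q : N) : 'rV[R]_n := \sum_j z j *: E j q.
have scE z j : smooth_vfield (fun q => z j *: E j q : 'rV[R]_n).
  exact: (section_Z (smooth_idfun N) openT (smooth_on_cst setT (z j : R^o)) (sE j)).
have scf z : smooth_vfield (cf z).
  exact: (section_sum (smooth_idfun N) (index_enum _) openT (scE z)).
have cN : connection (idfun : N -> N) nN by case: lcN.
have main Z (w z : 'I_n -> R) : smooth_vfield Z -> Z p *m tmap f p = cf w (f p) ->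
   \sum_j z j *: D Z (E j \o f) p = nN (cf w) (cf z) (f p).
  move=> sZ Zw; rewrite (conn_sumr (smooth_idfun N) cN _ (scf w) (scE z)).
  apply: eq_bigr => j _; rewrite (pullback_comp sZ (scf w) (sE j) Zw).
  rewrite (connZr cN (h := fun=> z j))// ?dfun_cst ?scale0r ?addr0//.
    exact: (smooth_on_cst setT (z j : R^o)).
  exact: sE.
have br0 : nN (cf x) (cf y) (f p) - nN (cf y) (cf x) (f p) = 0.
  rewrite [LHS]vE big1// => k _.
  case: lcN => _ tor _; rewrite tor//.
  have dcst (z : 'I_n -> R) v : dfun (fun q => dfun (kap k) q (cf z q)) (f p) v = 0.
    rewrite -(dfun_cst (z k) (f p) v).
    apply: (@dfun_near _ _ _ setT) => //; first exact: (smooth_on_cst setT (z k : R^o)).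
    apply: filterS (open_near oV Vp) => q Vq.
    rewrite /cf dfun_sumr (bigD1 k)//= dfunZr dual// eqxx mulr1 big1 ?addr0// => j jk.
    by rewrite dfunZr dual// (negPf jk) mulr0.
  by rewrite !dcst subrr scale0r.
have kf j : (fun q => dfun (kap j) (f q) (tapp (tmap f) Y q)) = fun q => dfun (kap j \o f) q (Y q).
  by apply/funext => q; rewrite (dfun_comp _ sf openT I (skap j)).
have kf' j : (fun q => dfun (kap j) (f q) (tapp (tmap f) X q)) = fun q => dfun (kap j \o f) q (X q).
  by apply/funext => q; rewrite (dfun_comp _ sf openT I (skap j)).
rewrite !expand// !big_split /=.
rewrite (main X x y sX (vE _)) (main Y y x sY (vE _)).
rewrite opprD addrACA br0 add0r -sumrB [RHS]vE; apply: eq_bigr => j _.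
rewrite -scalerBl kf kf' -(dfun_comp _ sf openT I (skap j)).
case: lcM => _ tor _; rewrite tor//.
exact: (smooth_map_comp sf openT (skap j)).
Qed.

Lemma pullback_ip_smooth s t : smooth_section f s -> smooth_section f t ->
  smooth_fun (fun q => ip (gN (f q)) (s q) (t q)).
Proof.
move=> ss st; apply: smooth_on_local => p _.
have [kap [E [chi [V [skap sE schi HE [oV Vp chi1 dual]]]]]] := cutoff_frame (f p).
have oU : open (f @^-1` V) by exact: preimage_open.
exists (f @^-1` V); split=> //.
pose G i j q : R := ip (gN q) (E i q) (E j q).
have sG i j : smooth_fun (G i j) by exact: (metric_smooth rgN openT (sE i) (sE j)).
have sc u j : smooth_section f u -> smooth_fun (fun q => dfun (kap j) (f q) (u q)).
  by move=> su; exact: (smooth_sectionP _ sf openT).1 su _ (skap j).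
apply: (smooth_on_eq (g := fun q => \sum_i dfun (kap i) (f q) (s q) *
   \sum_j dfun (kap j) (f q) (t q) * G i j (f q) : R^o)) => //.
  move=> q Vq.
  have vE v : v = \sum_j dfun (kap j) (f q) v *: E j (f q).
    by rewrite -HE chi1// scale1r.
  rewrite [in RHS](vE (s q)) ip_suml; apply: eq_bigr => i _; rewrite ipZl; congr (_ * _).
  rewrite [in RHS](vE (t q)) (ipC (metric_posdef rgN _)) ip_suml.
  by apply: eq_bigr => j _; rewrite ipZl (ipC (metric_posdef rgN _)).
apply: smooth_on_sub (@subsetT _ _) _.
apply: (smooth_on_sum _ openT) => i; apply: (smooth_onM openT); first exact: sc.
apply: (smooth_on_sum _ openT) => j; apply: (smooth_onM openT); first exact: sc.
exact: (smooth_map_comp sf openT (sG i j)).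
Qed.

(** Multiplying s by a cut-off chi that is 1 at p does not change T s, and chi s
    is a combination over functions of sections pulled back from the target. *)
Lemma tensor_section_eq0 (T : (M -> 'rV[R]_n) -> R) p :
  (forall s t, smooth_section f s -> smooth_section f t ->
     T (fun q => s q + t q) = T s + T t) ->
  (forall a s, smooth_fun a -> smooth_section f s -> T (fun q => a q *: s q) = a p * T s) ->
  (forall Y, smooth_vfield Y -> T (Y \o f) = 0) ->
  forall s, smooth_section f s -> T s = 0.
Proof.
move=> TD TZ T0 s ss.
have [kap [E [chi [V [skap sE schi HE [oV Vp chi1 dual]]]]]] := cutoff_frame (f p).
have sc : smooth_fun (chi \o f) by exact: (smooth_map_comp sf openT schi).
have ssig j : smooth_fun (fun q => dfun (kap j) (f q) (s q)).
  exact: (smooth_sectionP _ sf openT).1 ss _ (skap j).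
have := TZ _ _ sc ss; rewrite /= chi1// mul1r => <-.
rewrite (_ : (fun q => chi (f q) *: s q) =
   fun q => \sum_j dfun (kap j) (f q) (s q) *: (E j \o f) q); last first.
  by apply/funext => q; rewrite HE.
have s0 : smooth_section f (fun=> 0) := section_0 sf openT.
have T00 : T (fun=> 0) = 0.
  have := TZ _ _ (smooth_on_cst setT (0 : R^o) : smooth_fun (fun _ : M => 0)) s0.
  rewrite mul0r (_ : (fun q => 0 *: 0) = fun=> 0)//.
  by apply/funext => q; rewrite scaler0.
have sF j : smooth_section f (fun q => dfun (kap j) (f q) (s q) *: (E j \o f) q).
  exact: (section_Z sf openT (ssig j) (section_comp sf (sE j))).
suff H r : T (fun q => \sum_(j <- r) dfun (kap j) (f q) (s q) *: (E j \o f) q) = 0 by exact: H.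
elim: r => [|i r IH].
  rewrite (_ : (fun q => _) = fun=> 0)//; by apply/funext => q; rewrite big_nil.
rewrite (_ : (fun q => _) = fun q => dfun (kap i) (f q) (s q) *: (E i \o f) q
   + \sum_(j <- r) dfun (kap j) (f q) (s q) *: (E j \o f) q); last first.
  by apply/funext => q; rewrite big_cons.
rewrite TD//; last by apply: section_sum => //; exact: openT.
rewrite IH addr0 TZ//; last exact: section_comp.
by rewrite T0// mulr0.
Qed.

(** The defect of compatibility is linear over functions in each section, so it
    suffices to test it on fields pulled back from the target. *)
Lemma pullback_metric X s t p : smooth_vfield X -> smooth_section f s -> smooth_section f t ->
  dfun (fun q => ip (gN (f q)) (s q) (t q)) p (X p)
  = ip (gN (f p)) (D X s p) (t p) + ip (gN (f p)) (s p) (D X t p).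
Proof.
move=> sX ss st; apply: subr0_eq.
pose B s t := dfun (fun q => ip (gN (f q)) (s q) (t q)) p (X p)
  - (ip (gN (f p)) (D X s p) (t p) + ip (gN (f p)) (s p) (D X t p)).
have gC q u v : ip (gN q) u v = ip (gN q) v u by exact: (ipC (metric_posdef rgN q)).
have BC s' t' : B s' t' = B t' s'.
  rewrite /B; congr (_ - _); last by rewrite [LHS]addrC; congr (_ + _); exact: gC.
  suff -> : (fun q => ip (gN (f q)) (s' q) (t' q)) = fun q => ip (gN (f q)) (t' q) (s' q) by [].
  by apply/funext => q; rewrite gC.
have rD (a1 a2 b1 b2 c1 c2 : R) :
  a1 + a2 - (b1 + b2 + (c1 + c2)) = a1 - (b1 + c1) + (a2 - (b2 + c2)) by ring.
have rZ (a d e b c k : R) :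
  a * d + e * k - (a * b + k * e + a * c) = a * (d - (b + c)) by ring.
have BD t' : smooth_section f t' -> forall s1 s2, smooth_section f s1 -> smooth_section f s2 ->
    B (fun q => s1 q + s2 q) t' = B s1 t' + B s2 t'.
  move=> st' s1 s2 ss1 ss2; rewrite /B (connDr cD)// !ipE.
  rewrite (_ : (fun q => ip (gN (f q)) (s1 q + s2 q) (t' q)) =
    fun q => ip (gN (f q)) (s1 q) (t' q) + ip (gN (f q)) (s2 q) (t' q)).
    by rewrite (dfunD _ I (pullback_ip_smooth ss1 st') (pullback_ip_smooth ss2 st')) rD.
  by apply/funext => q; rewrite ipE.
have BZ t' : smooth_section f t' -> forall a s1, smooth_fun a -> smooth_section f s1 ->
    B (fun q => a q *: s1 q) t' = a p * B s1 t'.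
  move=> st' a s1 sa ss1; rewrite /B (connZr cD)// !ipE.
  rewrite (_ : (fun q => ip (gN (f q)) (a q *: s1 q) (t' q)) =
    fun q => a q * ip (gN (f q)) (s1 q) (t' q)).
    by rewrite (dfunM _ I sa (pullback_ip_smooth ss1 st')) rZ.
  by apply/funext => q; rewrite ipE.
apply: (tensor_section_eq0 (T := fun s => B s t) (p := p)) ss.
- exact: BD.
- exact: BZ.
move=> Y sY; rewrite BC.
have sYf : smooth_section f (Y \o f) by exact: section_comp.
apply: (tensor_section_eq0 (T := fun t => B t (Y \o f)) (p := p)) st.
- exact: BD.
- exact: BZ.
move=> Z sZ.
have [V sV Vp] := extend_vec (f p) (X p *m tmap f p).
rewrite /B /= (pullback_comp sX sV sZ (esym Vp)) (pullback_comp sX sV sY (esym Vp)).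
case: lcN => _ _ met; rewrite -met// Vp -(dfun_comp _ sf openT I) ?subrr//.
exact: (metric_smooth rgN openT sZ sY).
Qed.

End PullbackConnection.

(** * The Levi-Civita connection and Killing fields *)

(** The Lie bracket, which for a torsion-free connection is the
    antisymmetrised covariant derivative. It is locked to keep additivity of
    the metric from seeing a difference of vectors in it. *)
HB.lock Definition lie (R : realType) (m : nat) (M : manifold R m)
    (nab : (M -> 'rV[R]_m) -> (M -> 'rV[R]_m) -> M -> 'rV[R]_m)
    (X Y : M -> 'rV[R]_m) : M -> 'rV[R]_m := fun q => nab X Y q - nab Y X q.

Section LeviCivita.
Context {R : realType} {m : nat} {M : manifold R m}.
Variables (g : M -> 'M[R]_m).
Variable nab : (M -> 'rV[R]_m) -> (M -> 'rV[R]_m) -> M -> 'rV[R]_m.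
Hypotheses (rg : riemannian_metric g) (lc : levi_civita g nab).
Implicit Types (X Y Z : M -> 'rV[R]_m) (p q : M).
Local Notation br := (lie nab).

Lemma lieE X Y q : br X Y q = nab X Y q - nab Y X q.
Proof. by rewrite lie.unlock. Qed.

Lemma lie_fun X Y : br X Y = fun q => nab X Y q - nab Y X q.
Proof. by rewrite lie.unlock. Qed.

Let cn : connection (idfun : M -> M) nab. Proof. by case: lc. Qed.
Let sid := smooth_idfun M.

Lemma nab_smooth X Y : smooth_vfield X -> smooth_vfield Y -> smooth_vfield (nab X Y).
Proof. exact: conn_smooth. Qed.

Lemma vfieldD X Y : smooth_vfield X -> smooth_vfield Y -> smooth_vfield (fun q => X q + Y q).
Proof. exact: (section_D sid openT). Qed.

Lemma vfieldZ (a : M -> R) X : smooth_fun a -> smooth_vfield X ->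
  smooth_vfield (fun q => a q *: X q).
Proof. exact: (section_Z sid openT). Qed.

Lemma smooth_fun_cst (a : R) : smooth_fun (fun _ : M => a).
Proof. exact: (smooth_on_cst setT (a : R^o)). Qed.

Lemma vfieldZc (a : R) X : smooth_vfield X -> smooth_vfield (fun q => a *: X q).
Proof. exact: (vfieldZ (smooth_fun_cst a)). Qed.

Lemma vfieldB X Y : smooth_vfield X -> smooth_vfield Y -> smooth_vfield (fun q => X q - Y q).
Proof.
move=> sX sY; rewrite (_ : (fun q => _) = fun q => X q + -1 *: Y q).
  exact: vfieldD sX (vfieldZc (-1) sY).
by apply/funext => q; rewrite scaleN1r.
Qed.

Lemma nabDl X Y Z p : smooth_vfield X -> smooth_vfield Y -> smooth_vfield Z ->
  nab (fun q => X q + Y q) Z p = nab X Z p + nab Y Z p.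
Proof. exact: connDl. Qed.

Lemma nabDr X Y Z p : smooth_vfield X -> smooth_vfield Y -> smooth_vfield Z ->
  nab X (fun q => Y q + Z q) p = nab X Y p + nab X Z p.
Proof. exact: connDr. Qed.

Lemma nabZcl a X Z p : smooth_vfield X -> smooth_vfield Z ->
  nab (fun q => a *: X q) Z p = a *: nab X Z p.
Proof. exact: (connZl cn p (smooth_fun_cst a)). Qed.

Lemma nabZcr a X Z p : smooth_vfield X -> smooth_vfield Z ->
  nab X (fun q => a *: Z q) p = a *: nab X Z p.
Proof.
move=> sX sZ; rewrite (connZr cn (h := fun=> a))//; last exact: smooth_fun_cst.
by rewrite dfun_cst scale0r addr0.
Qed.

Lemma nab0r X p : smooth_vfield X -> nab X (fun=> 0) p = 0.
Proof. exact: (conn0r sid cn). Qed.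

Lemma nabBr X Y Z p : smooth_vfield X -> smooth_vfield Y -> smooth_vfield Z ->
  nab X (fun q => Y q - Z q) p = nab X Y p - nab X Z p.
Proof.
move=> sX sY sZ; rewrite (_ : (fun q => _) = fun q => Y q + -1 *: Z q); last first.
  by apply/funext => q; rewrite scaleN1r.
by rewrite nabDr// ?nabZcr ?scaleN1r//; exact: vfieldZc.
Qed.

Lemma nabBl X Y Z p : smooth_vfield X -> smooth_vfield Y -> smooth_vfield Z ->
  nab (fun q => X q - Y q) Z p = nab X Z p - nab Y Z p.
Proof.
move=> sX sY sZ; rewrite (_ : (fun q => _) = fun q => X q + -1 *: Y q); last first.
  by apply/funext => q; rewrite scaleN1r.
by rewrite nabDl// ?nabZcl ?scaleN1r//; exact: vfieldZc.
Qed.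

Lemma nab_metric X Y Z p : smooth_vfield X -> smooth_vfield Y -> smooth_vfield Z ->
  dfun (fun q => ip (g q) (Y q) (Z q)) p (X p)
  = ip (g p) (nab X Y p) (Z p) + ip (g p) (Y p) (nab X Z p).
Proof. by case: lc => _ _; apply. Qed.

Lemma nab_metric0 X Y Z p : smooth_vfield X -> smooth_vfield Y -> smooth_vfield Z ->
  (forall q, ip (g q) (Y q) (Z q) = 0) ->
  ip (g p) (nab X Y p) (Z p) = - ip (g p) (Y p) (nab X Z p).
Proof.
move=> sX sY sZ YZ; apply/eqP; rewrite -addr_eq0 -nab_metric//.
by under eq_fun do rewrite YZ; rewrite dfun_cst.
Qed.

Lemma ip_smooth X Y : smooth_vfield X -> smooth_vfield Y ->
  smooth_fun (fun q => ip (g q) (X q) (Y q)).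
Proof. exact: (metric_smooth rg openT). Qed.

Lemma ip_sym p u v : ip (g p) u v = ip (g p) v u.
Proof. exact: (ipC (metric_posdef rg p)). Qed.

Definition deriv_along X (h : M -> R) : M -> R := fun q => dfun h q (X q).

Lemma deriv_along_smooth X h : smooth_vfield X -> smooth_fun h -> smooth_fun (deriv_along X h).
Proof. by move=> sX sh; exact: (dfun_smooth openT sh sX). Qed.

Lemma deriv_alongD X (h k : M -> R) p : smooth_fun h -> smooth_fun k ->
  deriv_along X (fun q => h q + k q) p = deriv_along X h p + deriv_along X k p.
Proof. by move=> sh sk; exact: (dfunD _ (A := setT)). Qed.

Lemma deriv_alongN X (h : M -> R) p : smooth_fun h -> deriv_along X (fun q => - h q) p = - deriv_along X h p.
Proof.
move=> sh; rewrite /deriv_along (_ : (fun q => - h q) = fun q => -1 * h q); last first.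
  by apply/funext => q; rewrite mulN1r.
rewrite (dfunM _ (A := setT) (g := fun=> -1))//; last exact: smooth_fun_cst.
by rewrite dfun_cst mulr0 addr0 mulN1r.
Qed.

Lemma deriv_alongB X (h k : M -> R) p : smooth_fun h -> smooth_fun k ->
  deriv_along X (fun q => h q - k q) p = deriv_along X h p - deriv_along X k p.
Proof.
move=> sh sk; rewrite deriv_alongD ?deriv_alongN//.
exact: (smooth_onN openT sk).
Qed.

Lemma lie_smooth X Y : smooth_vfield X -> smooth_vfield Y -> smooth_vfield (br X Y).
Proof. by move=> sX sY; rewrite lie_fun; apply: vfieldB; exact: nab_smooth. Qed.

Lemma deriv_along_lie X Y h : smooth_vfield X -> smooth_vfield Y -> smooth_fun h ->
  deriv_along (br X Y) h = fun q => deriv_along X (deriv_along Y h) q - deriv_along Y (deriv_along X h) q.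
Proof. by move=> sX sY sh; apply/funext => q; rewrite /deriv_along lieE; case: lc => _ tor _; exact: tor. Qed.

(** Both sides act on functions by the same commutators of derivations. *)
Lemma jacobi X Y Z p : smooth_vfield X -> smooth_vfield Y -> smooth_vfield Z ->
  br Z (br X Y) p = br (br Z X) Y p + br X (br Z Y) p.
Proof.
move=> sX sY sZ; apply: subr0_eq; apply: (vec_eq0 (p := p)) => h sh.
have sXY := lie_smooth sX sY; have sZX := lie_smooth sZ sX; have sZY := lie_smooth sZ sY.
have e A : dfun h p (A p) = deriv_along A h p by [].
rewrite (dfunDr _ _ (br Z (br X Y) p)) dfunNr (dfunDr _ _ (br (br Z X) Y p)) !e.
have s2 A B : smooth_vfield A -> smooth_vfield B -> smooth_fun (deriv_along A (deriv_along B h)).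
  by move=> sA sB; do 2![apply: deriv_along_smooth => //].
rewrite (deriv_along_lie sZ sXY sh) (deriv_along_lie sZX sY sh) (deriv_along_lie sX sZY sh).
rewrite (deriv_along_lie sX sY sh) (deriv_along_lie sZ sX sh) (deriv_along_lie sZ sY sh).
rewrite (deriv_along_lie sX sY (deriv_along_smooth sZ sh)) (deriv_along_lie sZ sX (deriv_along_smooth sY sh)).
rewrite (deriv_along_lie sZ sY (deriv_along_smooth sX sh)).
rewrite (deriv_alongB Z p (s2 _ _ sX sY) (s2 _ _ sY sX)) (deriv_alongB Y p (s2 _ _ sZ sX) (s2 _ _ sX sZ)).
rewrite (deriv_alongB X p (s2 _ _ sZ sY) (s2 _ _ sY sZ)).
move: (deriv_along X (deriv_along Y (deriv_along Z h)) p) (deriv_along Y (deriv_along X (deriv_along Z h)) p) (deriv_along X (deriv_along Z (deriv_along Y h)) p)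
  (deriv_along Z (deriv_along X (deriv_along Y h)) p) (deriv_along Y (deriv_along Z (deriv_along X h)) p) (deriv_along Z (deriv_along Y (deriv_along X h)) p) => *.
ring.
Qed.

Section Killing.
Variable zeta : M -> 'rV[R]_m.
Hypothesis sz : smooth_vfield zeta.
Hypothesis kz : forall X Y p, smooth_vfield X -> smooth_vfield Y ->
  ip (g p) (nab X zeta p) (Y p) + ip (g p) (X p) (nab Y zeta p) = 0.

Lemma killing_metric X Y p : smooth_vfield X -> smooth_vfield Y ->
  dfun (fun q => ip (g q) (X q) (Y q)) p (zeta p)
  = ip (g p) (br zeta X p) (Y p) + ip (g p) (X p) (br zeta Y p).
Proof.
move=> sX sY; rewrite nab_metric// !lieE !ipE.
have := kz p sX sY; move: (ip _ _ _) (ip _ _ _) (ip _ _ _) (ip _ _ _) => a b c d.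
by move=> ab; rewrite addrACA -opprD ab subr0.
Qed.

Lemma killing_metric0 X Y p : smooth_vfield X -> smooth_vfield Y ->
  (forall q, ip (g q) (X q) (Y q) = 0) ->
  ip (g p) (br zeta X p) (Y p) = - ip (g p) (X p) (br zeta Y p).
Proof.
move=> sX sY XY; apply/eqP; rewrite -addr_eq0 -killing_metric//.
by under eq_fun do rewrite XY; rewrite dfun_cst.
Qed.

Let K X Y p := br zeta (nab X Y) p - nab (br zeta X) Y p - nab X (br zeta Y) p.

Let K_sym X Y p : smooth_vfield X -> smooth_vfield Y -> K X Y p = K Y X p.
Proof.
move=> sX sY; apply: subr0_eq.
have sXY := nab_smooth sX sY; have sYX := nab_smooth sY sX.
have := jacobi p sX sY sz; rewrite {1}lieE {1}[br X Y]lie_fun nabBr// {1}[br X Y]lie_fun nabBl// => /eqP.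
rewrite -subr_eq0 => /eqP <-; rewrite /K !lieE.
move: (nab zeta (nab X Y) p) (nab zeta (nab Y X) p) (nab (nab X Y) zeta p)
  (nab (nab Y X) zeta p) (nab (br zeta Y) X p) (nab (br zeta X) Y p)
  (nab X (br zeta Y) p) (nab Y (br zeta X) p) => *.
by apply/rowP => i; rewrite !mxE; ring.
Qed.

Let K_skew X Y Z p : smooth_vfield X -> smooth_vfield Y -> smooth_vfield Z ->
  ip (g p) (K X Y p) (Z p) = - ip (g p) (K X Z p) (Y p).
Proof.
move=> sX sY sZ.
have sXY := nab_smooth sX sY; have sXZ := nab_smooth sX sZ.
have lX := lie_smooth sz sX; have lY := lie_smooth sz sY; have lZ := lie_smooth sz sZ.
pose F q := ip (g q) (Y q) (Z q).
have sF : smooth_fun F by exact: ip_smooth.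
have E1 : deriv_along X F = fun q => ip (g q) (nab X Y q) (Z q) + ip (g q) (Y q) (nab X Z q).
  by apply/funext => q; exact: nab_metric.
have E2 : deriv_along zeta F = fun q => ip (g q) (br zeta Y q) (Z q) + ip (g q) (Y q) (br zeta Z q).
  by apply/funext => q; exact: killing_metric.
have : deriv_along (br zeta X) F p = deriv_along zeta (deriv_along X F) p - deriv_along X (deriv_along zeta F) p.
  by rewrite (deriv_along_lie sz sX sF).
rewrite E1 E2.
rewrite (deriv_alongD _ _ (ip_smooth sXY sZ) (ip_smooth sY sXZ)).
rewrite (deriv_alongD _ _ (ip_smooth lY sZ) (ip_smooth sY lZ)).
rewrite /deriv_along !killing_metric// !nab_metric//.
rewrite /K !ipE.
rewrite -[ip (g p) (br zeta (nab X Z) p) _]ip_sym -[ip (g p) (nab (br zeta X) Z p) _]ip_sym -[ip (g p) (nab X (br zeta Z) p) _]ip_sym.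
have r (a b c d e f k i : R) : a + b = c + d + (e + f) - (k + e + (d + i)) ->
    c - a - k = - (f - b - i) by move=> H; lra.
exact: r.
Qed.

(** The defect K is symmetric in X and Y by the Jacobi identity, while
    g(K(X,Y),Z) is skew in Y and Z because the flow preserves g; a trilinear form
    with both symmetries is zero. *)
Lemma killing_nab X Y p : smooth_vfield X -> smooth_vfield Y ->
  br zeta (nab X Y) p = nab (br zeta X) Y p + nab X (br zeta Y) p.
Proof.
move=> sX sY; apply: subr0_eq; rewrite opprD addrA -/(K X Y p).
apply: (ip_ext (metric_posdef rg p)) => v.
have [Z sZ <-] := extend_vec p v.
have T A B C : smooth_vfield A -> smooth_vfield B -> smooth_vfield C ->
  ip (g p) (K A B p) (C p) = - ip (g p) (K C A p) (B p).
  by move=> sA sB sC; rewrite K_skew// (K_sym p sA sC).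
have H : ip (g p) (K X Y p) (Z p) = - ip (g p) (K X Y p) (Z p).
  by rewrite {1}T// T// T// opprK.
by move: H; move: (ip _ _ _) => c cc; lra.
Qed.
End Killing.
End LeviCivita.

(** * Horizontally conformal submersions *)

Section Submersion.
Context {R : realType} {m n : nat} {M : manifold R m} {N : manifold R n}.
Variables (gM : M -> 'M[R]_m) (gN : N -> 'M[R]_n).
Variables (nab : (M -> 'rV[R]_m) -> (M -> 'rV[R]_m) -> M -> 'rV[R]_m)
    (nabN : (N -> 'rV[R]_n) -> (N -> 'rV[R]_n) -> N -> 'rV[R]_n)
    (D : (M -> 'rV[R]_m) -> (M -> 'rV[R]_n) -> M -> 'rV[R]_n)
    (Psi : M -> N) (lam : M -> R).
Hypotheses (rgM : riemannian_metric gM) (rgN : riemannian_metric gN).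
Hypotheses (lcM : levi_civita gM nab) (lcN : levi_civita gN nabN).
Hypothesis pD : pullback_connection Psi nabN D.
Hypothesis hcs : horizontally_conformal_submersion gM gN Psi lam.
Implicit Types (X Y Z W : M -> 'rV[R]_m) (p q : M) (u v w : 'rV[R]_m).
Local Notation br := (lie nab).
Local Notation push := (tapp (tmap Psi)).

Lemma subm_smooth : smooth_map Psi. Proof. by case: hcs => _ []. Qed.
Lemma subm_full p : row_full (tmap Psi p). Proof. by case: hcs => _ []. Qed.
Lemma dil_smooth : smooth_fun lam. Proof. by case: hcs => _ _ []. Qed.
Lemma dil_gt0 p : 0 < lam p. Proof. by case: hcs => _ _ []. Qed.

Lemma verE p u : (u <= ver Psi p)%MS = (u *m tmap Psi p == 0).
Proof. exact: sub_kermx. Qed.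

Lemma horP p v : reflect (forall u, (u <= ver Psi p)%MS -> ip (gM p) v u = 0)
  (v <= hor gM Psi p)%MS.
Proof. exact: orthP. Qed.

Lemma verP p v : (forall u, (u <= hor gM Psi p)%MS -> ip (gM p) v u = 0) ->
  (v <= ver Psi p)%MS.
Proof.
move=> H; rewrite -(orthK (metric_posdef rgM p)); apply/orthP => u /H //.
Qed.

Lemma vproj_ver p v : (v *m vproj gM Psi p <= ver Psi p)%MS.
Proof. exact: oproj_sub. Qed.

Lemma hprojE p v : v *m hproj gM Psi p = v - v *m vproj gM Psi p.
Proof. exact: (oproj_orth (metric_posdef rgM p)). Qed.

Lemma hproj_hor p v : (v *m hproj gM Psi p <= hor gM Psi p)%MS.
Proof. exact: oproj_sub. Qed.

Lemma vproj_id p v : (v <= ver Psi p)%MS -> v *m vproj gM Psi p = v.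
Proof.
by move=> vv; apply: (oproj_unique (metric_posdef rgM p)) => //; rewrite subrr sub0mx.
Qed.

Lemma hproj_ver0 p v : (v <= ver Psi p)%MS -> v *m hproj gM Psi p = 0.
Proof. by move=> vv; rewrite hprojE vproj_id// subrr. Qed.

Lemma hproj_id p v : (v <= hor gM Psi p)%MS -> v *m hproj gM Psi p = v.
Proof.
move=> vh; apply: (oproj_unique (metric_posdef rgM p)) => //.
by rewrite subrr sub0mx.
Qed.

Lemma ip_hproj p u v : (u <= hor gM Psi p)%MS ->
  ip (gM p) u (v *m hproj gM Psi p) = ip (gM p) u v.
Proof.
by move=> /horP uh; rewrite hprojE ipDr ipNr (uh _ (vproj_ver _ _)) subr0.
Qed.

Lemma hproj_tmap p v : v *m hproj gM Psi p *m tmap Psi p = v *m tmap Psi p.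
Proof.
rewrite hprojE mulmxBl; have := vproj_ver p v; rewrite verE => /eqP ->.
by rewrite subr0.
Qed.

Lemma extend_ver p u : (u <= ver Psi p)%MS -> exists2 X, Gamma (ver Psi) X & X p = u.
Proof.
move=> uv; have [X sX Xp] := extend_vec p u.
exists (tapp (vproj gM Psi) X); last by rewrite /tapp Xp vproj_id.
split=> [|q]; last exact: vproj_ver.
exact: (vproj_smooth rgM subm_smooth subm_full).
Qed.

Lemma Gamma_hproj X : smooth_vfield X -> Gamma (hor gM Psi) (tapp (hproj gM Psi) X).
Proof.
move=> sX; split=> [|q]; last exact: hproj_hor.
exact: (hproj_smooth rgM subm_smooth subm_full).
Qed.

Lemma Gamma_vproj X : smooth_vfield X -> Gamma (ver Psi) (tapp (vproj gM Psi) X).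
Proof.
move=> sX; split=> [|q]; last exact: vproj_ver.
exact: (vproj_smooth rgM subm_smooth subm_full).
Qed.

Lemma extend_hor p u : (u <= hor gM Psi p)%MS -> exists2 X, Gamma (hor gM Psi) X & X p = u.
Proof.
move=> uh; have [X sX Xp] := extend_vec p u.
exists (tapp (hproj gM Psi) X); last by rewrite /tapp Xp hproj_id.
exact: Gamma_hproj.
Qed.

Lemma ver_push0 W : Gamma (ver Psi) W -> push W = fun=> 0.
Proof. by move=> [_ vW]; apply/funext => q; apply/eqP; rewrite -verE. Qed.

Lemma push_torsion X Y p : smooth_vfield X -> smooth_vfield Y ->
  D X (push Y) p - D Y (push X) p = br X Y p *m tmap Psi p.
Proof.
by move=> sX sY; rewrite lieE; exact: (pullback_torsion subm_smooth lcM lcN pD).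
Qed.

Lemma push_conn0 X p : smooth_vfield X -> D X (fun=> 0) p = 0.
Proof. by case: pD => cD _; exact: (conn0r subm_smooth cD). Qed.

(** Torsion-freeness along Psi, as Psi_* W and Psi_* V are zero. *)
Lemma ver_br W V p : Gamma (ver Psi) W -> Gamma (ver Psi) V -> (br W V p <= ver Psi p)%MS.
Proof.
move=> GW GV; rewrite verE -push_torsion; [|exact: GW.1|exact: GV.1].
by rewrite !ver_push0// !push_conn0 ?subrr//; [exact: GV.1|exact: GW.1].
Qed.

Lemma gN_push p (A Y : 'rV[R]_m) : (Y <= hor gM Psi p)%MS ->
  ip (gN (Psi p)) (A *m tmap Psi p) (Y *m tmap Psi p) = lam p ^+ 2 * ip (gM p) A Y.
Proof.
move=> hY; rewrite -hproj_tmap.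
case: hcs => _ _ _ H; rewrite H ?hproj_hor//.
by rewrite (ip_sym rgM) ip_hproj// (ip_sym rgM).
Qed.

Local Notation dil2 := (fun q => lam q ^+ 2).

Lemma dil2_smooth : smooth_fun dil2.
Proof.
rewrite (_ : dil2 = fun q => lam q * lam q); last first.
  by apply/funext => q; rewrite expr2.
exact: (smooth_onM openT dil_smooth dil_smooth).
Qed.

(** Metricity along Psi: on horizontal fields the pulled-back metric is
    lambda^2 g. *)
Lemma push_metric X Y Z p : smooth_vfield X -> Gamma (hor gM Psi) Y -> Gamma (hor gM Psi) Z ->
  ip (gN (Psi p)) (D X (push Y) p) (push Z p) + ip (gN (Psi p)) (D X (push Z) p) (push Y p)
  = lam p ^+ 2 * (ip (gM p) (nab X Y p) (Z p) + ip (gM p) (nab X Z p) (Y p))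
    + dfun dil2 p (X p) * ip (gM p) (Y p) (Z p).
Proof.
move=> sX GY GZ; have [sY hY] := GY; have [sZ hZ] := GZ.
have pY := section_tmap subm_smooth sY; have pZ := section_tmap subm_smooth sZ.
rewrite [X in _ + X](ipC (metric_posdef rgN _)).
rewrite -(pullback_metric subm_smooth rgN lcN pD p sX pY pZ).
rewrite (_ : (fun q => ip _ _ _) = fun q => lam q ^+ 2 * ip (gM q) (Y q) (Z q)).
  rewrite (dfunM _ (I : setT p) dil2_smooth (ip_smooth rgM sY sZ)).
  rewrite (nab_metric lcM p sX sY sZ) (ip_sym rgM p (Y p) (nab X Z p)).
  by rewrite [X in _ + X]mulrC.
by apply/funext => q; rewrite /tapp gN_push.
Qed.

(** The second fundamental form of a horizontally conformal submersion on
    horizontal fields, by the Koszul argument: its pairing e(X,Y,Z) with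
    Psi_*Z is symmetric in X, Y by push_torsion-freeness, and e(X,Y,Z) + e(X,Z,Y)
    is the derivative of lambda^2 along X times g(Y,Z). *)
Lemma conformal_sff X Y Z p :
  Gamma (hor gM Psi) X -> Gamma (hor gM Psi) Y -> Gamma (hor gM Psi) Z ->
  2 * (ip (gN (Psi p)) (D X (push Y) p) (push Z p) - lam p ^+ 2 * ip (gM p) (nab X Y p) (Z p))
  = dfun dil2 p (X p) * ip (gM p) (Y p) (Z p) + dfun dil2 p (Y p) * ip (gM p) (X p) (Z p)
    - dfun dil2 p (Z p) * ip (gM p) (X p) (Y p).
Proof.
move=> GX GY GZ; have [sX hX] := GX; have [sY hY] := GY; have [sZ hZ] := GZ.
pose e A B C := ip (gN (Psi p)) (D A (push B) p) (push C p) - lam p ^+ 2 * ip (gM p) (nab A B p) (C p).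
have e_sym A B C : Gamma (hor gM Psi) A -> Gamma (hor gM Psi) B -> Gamma (hor gM Psi) C ->
    e A B C = e B A C.
  move=> [sA _] [sB _] [_ hC]; apply: subr0_eq.
  have := gN_push (br A B p) (hC p); rewrite -push_torsion// lieE !ipE => h.
  have r (a b c d l : R) : a - b = l * (c - d) -> a - l * c - (b - l * d) = 0.
    by move=> H; lra.
  exact: r.
have e_met A B C : Gamma (hor gM Psi) A -> Gamma (hor gM Psi) B -> Gamma (hor gM Psi) C ->
    e A B C + e A C B = dfun dil2 p (A p) * ip (gM p) (B p) (C p).
  move=> [sA _] GB GC; have := push_metric p sA GB GC.
  have r (a b c d l k : R) : a + b = l * (c + d) + k -> a - l * c + (b - l * d) = k.
    by move=> H; lra.
  exact: r.
have h1 := e_met X Y Z GX GY GZ; have h2 := e_met Y X Z GY GX GZ.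
have h3 := e_met Z X Y GZ GX GY.
rewrite -/(e X Y Z) -h1 -h2 -h3 (e_sym Y X Z)// (e_sym Z X Y)// (e_sym Z Y X)//.
move: (e X Y Z) (e X Z Y) (e Y Z X) => a b c; ring.
Qed.

(** For vertical W, Psi_* W = 0 makes the pulled-back derivative of Psi_* X along
    W the image of the bracket of W and X. Hence the Lie derivative of g along
    W is, on horizontal vectors, a multiple of g. *)
Lemma conformal_ver X Y W p : Gamma (hor gM Psi) X -> Gamma (hor gM Psi) Y ->
  Gamma (ver Psi) W ->
  dfun dil2 p (W p) * ip (gM p) (X p) (Y p)
  = - lam p ^+ 2 * (ip (gM p) (nab X W p) (Y p) + ip (gM p) (nab Y W p) (X p)).
Proof.
move=> GX GY GW; have [sX hX] := GX; have [sY hY] := GY; have [sW _] := GW.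
have DW A : smooth_vfield A -> D W (push A) p = br W A p *m tmap Psi p.
  by move=> sA; rewrite -push_torsion// (ver_push0 GW) push_conn0// subr0.
have := push_metric p sW GX GY; rewrite !DW// /tapp !gN_push// !lieE !ipE.
move: (ip _ (nab W X p) _) (ip _ (nab W Y p) _) (ip _ (nab X W p) _) (ip _ (nab Y W p) _).
move: (dfun _ _ _ * _) (lam p ^+ 2) => k l a b c d H.
have -> : k = l * (a - c) + l * (b - d) - l * (a + b) by rewrite H addrC addKr.
ring.
Qed.

Lemma dfun_ln_dil p v : dfun (fun q => ln (lam q)) p v = dfun dil2 p v / (2 * lam p ^+ 2).
Proof.
have l0 := dil_gt0 p.
have -> : dfun dil2 p v = 2 * lam p * dfun lam p v.
  rewrite (_ : dil2 = fun q => lam q * lam q); last first.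
    by apply/funext => q; rewrite expr2.
  rewrite (dfunM _ (I : setT p) dil_smooth dil_smooth); ring.
have -> : 2 * lam p * dfun lam p v / (2 * lam p ^+ 2) = (lam p)^-1 * dfun lam p v.
  by field; rewrite gt_eqF.
have dl := smooth_tdifferentiable (I : setT p) dil_smooth.
have cp : cdom (chart_at p) p by exact: chart_at_dom.
have dn : differentiable (@ln R) (lam p).
  by apply/derivable1_diffP; have := is_derive1_ln l0; case.
have dn' : differentiable (@ln R) ((lam \o cinv (chart_at p)) (chart_at p p)).
  by rewrite /= cfunK.
apply: etrans (congr1 (@^~ v) (diff_comp dl dn')) _ => /=.
rewrite cfunK// deriv1E; last by apply/derivable1_diffP.
by rewrite derive1E (@derive_val _ _ _ _ _ _ _ (is_derive1_ln l0)) mulrC.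
Qed.

End Submersion.

(** * Submersions from Sasakian manifolds *)

Section SasakianSubmersion.
Context {R : realType} {m n : nat} {M : manifold R m} {N : manifold R n}.
Variables (phi : M -> 'M[R]_m) (zeta : M -> 'rV[R]_m) (eta : M -> 'cV[R]_m)
    (gM : M -> 'M[R]_m) (gN : N -> 'M[R]_n)
    (nab : (M -> 'rV[R]_m) -> (M -> 'rV[R]_m) -> M -> 'rV[R]_m)
    (nabN : (N -> 'rV[R]_n) -> (N -> 'rV[R]_n) -> N -> 'rV[R]_n)
    (D : (M -> 'rV[R]_m) -> (M -> 'rV[R]_n) -> M -> 'rV[R]_n)
    (Psi : M -> N) (lam : M -> R) (D1 : M -> 'M[R]_m).
Hypotheses (lcM : levi_civita gM nab) (sas : sasakian phi zeta eta gM nab).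
Hypotheses (rgN : riemannian_metric gN) (lcN : levi_civita gN nabN).
Hypothesis pD : pullback_connection Psi nabN D.
Hypothesis sub : semi_invariant_conformal_submersion phi zeta gM gN Psi lam D1.
Implicit Types (X Y Z W V xi : M -> 'rV[R]_m) (p q : M) (u v w y : 'rV[R]_m).
Local Notation br := (lie nab).
Local Notation push := (tapp (tmap Psi)).
Local Notation ph := (tapp phi).
Local Notation GV := (Gamma (ver Psi)).
Local Notation GH := (Gamma (hor gM Psi)).

Let acm : almost_contact_metric phi zeta eta gM. Proof. by case: sas. Qed.
Let rgM : riemannian_metric gM. Proof. by case: acm => _ []. Qed.
Let hcs : horizontally_conformal_submersion gM gN Psi lam. Proof. by case: sub. Qed.
Let sz : smooth_vfield zeta. Proof. by case: acm => _ []. Qed.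

Lemma phi_field_smooth X : smooth_vfield X -> smooth_vfield (ph X).
Proof. by case: acm => _ [sp _ _ _] _ _ sX; exact: sp openT sX. Qed.

Lemma etaE p u : ev (eta p) u = ip (gM p) u (zeta p).
Proof. by case: acm => _ _ _ [H _ _]; rewrite H. Qed.

Lemma metric_sym p u v : ip (gM p) u v = ip (gM p) v u.
Proof. exact: (ip_sym rgM). Qed.

Lemma phi_sqr p u : u *m phi p *m phi p = - u + ip (gM p) u (zeta p) *: zeta p.
Proof. by case: acm => _ _ [H _ _ _] _; rewrite H etaE. Qed.

Lemma phi_reeb p : zeta p *m phi p = 0.
Proof. by case: acm => _ _ [_ H _ _] _; exact: H. Qed.

Lemma phi_orth_reeb p u : ip (gM p) (u *m phi p) (zeta p) = 0.
Proof. by case: acm => _ _ [_ _ H _] _; rewrite -etaE. Qed.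

Lemma reeb_unit p : ip (gM p) (zeta p) (zeta p) = 1.
Proof. by case: acm => _ _ [_ _ _ H] _; rewrite -etaE. Qed.

Lemma phi_iso p u v : ip (gM p) (u *m phi p) (v *m phi p)
  = ip (gM p) u v - ip (gM p) u (zeta p) * ip (gM p) v (zeta p).
Proof. by case: acm => _ _ _ [_ H _]; rewrite H !etaE. Qed.

Lemma phi_skew p u v : ip (gM p) (u *m phi p) v = - ip (gM p) u (v *m phi p).
Proof. by case: acm => _ _ _ [_ _ H]; exact: H. Qed.

Lemma nab_phi_field X Y p : smooth_vfield X -> smooth_vfield Y ->
  nab X (ph Y) p = nab X Y p *m phi p + ip (gM p) (X p) (Y p) *: zeta p
    - ip (gM p) (Y p) (zeta p) *: X p.
Proof.
move=> sX sY; case: sas => _ H _; have := H X Y p sX sY.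
by rewrite etaE => /(canRL (subrK _)) ->; rewrite addrC addrA.
Qed.

Lemma nab_reeb X p : smooth_vfield X -> nab X zeta p = - (X p *m phi p).
Proof. by case: sas => _ _ H; exact: H. Qed.

Lemma ver_orth_reeb p u : (u <= ver Psi p)%MS -> ip (gM p) u (zeta p) = 0.
Proof. by case: sub => _ H _ _ uv; rewrite metric_sym; exact: (horP _ _ _ _ (H p)). Qed.

Lemma reeb_hor : GH zeta.
Proof. by split=> // p; case: sub. Qed.

(** The Reeb field is Killing, since its covariant derivative - phi is skew. *)
Lemma reeb_killing X Y p : smooth_vfield X -> smooth_vfield Y ->
  ip (gM p) (nab X zeta p) (Y p) + ip (gM p) (X p) (nab Y zeta p) = 0.
Proof.
by move=> sX sY; rewrite !nab_reeb// ipNl ipNr phi_skew opprK subrr.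
Qed.

Lemma lie_reeb X p : smooth_vfield X -> br zeta X p = nab zeta X p + X p *m phi p.
Proof. by move=> sX; rewrite lieE nab_reeb// opprK. Qed.

(** The flow of the Reeb field preserves phi, since nabla_zeta phi = 0. *)
Lemma lie_reeb_phi X p : smooth_vfield X -> br zeta (ph X) p = br zeta X p *m phi p.
Proof.
move=> sX; rewrite !lie_reeb//; last exact: phi_field_smooth.
rewrite nab_phi_field// mulmxDl metric_sym; congr (_ + _).
by rewrite addrK.
Qed.

Lemma lie_reeb_reeb p : br zeta zeta p = 0. Proof. by rewrite lieE subrr. Qed.

(** For vertical X and Y the bracket is vertical, while its zeta-component is
    2 g(phi X, Y): so phi maps vertical vectors to horizontal ones. *)
Lemma phi_ver_orth p u v : (u <= ver Psi p)%MS -> (v <= ver Psi p)%MS ->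
  ip (gM p) (u *m phi p) v = 0.
Proof.
move=> uv vv.
have [X GX Xp] := extend_ver rgM hcs uv; have [Y GY Yp] := extend_ver rgM hcs vv.
have [sX vX] := GX; have [sY vY] := GY.
have nz A B : GV A -> GV B -> ip (gM p) (nab A B p) (zeta p) = ip (gM p) (B p) (A p *m phi p).
  move=> [sA vA] [sB vB].
  rewrite (nab_metric0 lcM p sA sB sz (fun q => ver_orth_reeb (vB q))).
  by rewrite (nab_reeb _ sA) ipNr opprK.
have := ver_orth_reeb (ver_br lcM lcN pD hcs p GX GY).
rewrite lieE ipDl ipNl !nz// -Xp -Yp.
rewrite (metric_sym _ (Y p)) [ip _ (X p) _]metric_sym (phi_skew p (Y p)) (metric_sym _ (Y p)).
by move: (ip _ _ _) => c; lra.
Qed.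

Lemma phi_ver_hor p u : (u <= ver Psi p)%MS -> (u *m phi p <= hor gM Psi p)%MS.
Proof. by move=> uv; apply/horP => v vv; exact: phi_ver_orth. Qed.

(** phi^2 = - id on vectors orthogonal to zeta. *)
Lemma ver_phi_inj p u : (u <= ver Psi p)%MS -> u *m phi p = 0 -> u = 0.
Proof.
move=> uv u0; have := phi_sqr p u; rewrite u0 mul0mx ver_orth_reeb// scale0r addr0.
by move=> /esym /eqP; rewrite oppr_eq0 => /eqP.
Qed.

(** D1 = phi D1 is vertical and, being the image of vertical vectors under phi,
    horizontal. *)
Lemma D1_eq0 p u : (u <= D1 p)%MS -> u = 0.
Proof.
case: sub => _ _ [_ D1v] HD uD.
have uv := submx_trans uD (D1v p).
apply: (ver_phi_inj uv); apply: (ip_eq0 (metric_posdef rgM p)).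
apply: phi_ver_orth => //; apply: submx_trans (D1v p).
by rewrite -(HD p).1 submxMr.
Qed.

Lemma D2_ver p : (D2 gM Psi D1 p :=: ver Psi p)%MS.
Proof.
apply/eqmxP; rewrite /D2 capmxSl /= sub_capmx submx_refl /=.
apply/row_subP => i; apply/orthP => w /D1_eq0 ->; exact: ip0r.
Qed.

Lemma GammaD2 X : Gamma (D2 gM Psi D1) X <-> GV X.
Proof. by split=> -[sX vX]; split=> // p; have := vX p; rewrite D2_ver. Qed.

Lemma alphaE Z : alpha phi gM Psi D1 Z = tapp (vproj gM Psi) (ph Z).
Proof.
by apply/funext => p; exact: (oproj_eqmx (metric_posdef rgM p) _ (D2_ver p)).
Qed.

Lemma alpha_ver Z : smooth_vfield Z -> GV (alpha phi gM Psi D1 Z).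
Proof. by move=> sZ; rewrite alphaE; apply: (Gamma_vproj rgM hcs); exact: phi_field_smooth. Qed.

(** For horizontal Z the part of phi Z orthogonal to the fibre is orthogonal to
    phi D2 as well, because Z is orthogonal to D2. So mu receives exactly the
    horizontal part, which also makes beta Z smooth. *)
Lemma betaE Z : (forall p, (Z p <= hor gM Psi p)%MS) ->
  beta phi gM Psi D1 Z = tapp (hproj gM Psi) (ph Z).
Proof.
move=> hZ; apply/funext => p; apply: (oproj_unique (metric_posdef rgM p)).
  rewrite /mu sub_capmx hproj_hor /=; apply/orthP => w /submxP[x ->].
  rewrite mulmxA.
  have vx : (x *m D2 gM Psi D1 p <= ver Psi p)%MS by rewrite -(D2_ver p) submxMl.
  rewrite /tapp metric_sym ip_hproj//; last exact: phi_ver_hor.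
  rewrite phi_iso (ver_orth_reeb vx) mul0r subr0 metric_sym.
  exact: (horP _ _ _ _ (hZ p)).
rewrite /tapp hprojE// opprB addrC subrK.
apply/orthP => w; rewrite /mu sub_capmx => /andP[/horP hw _].
by rewrite metric_sym; apply: hw; exact: vproj_ver.
Qed.

(** The orthogonal complement of zeta in mu. *)
Definition transverse p y := [/\ forall u, (u <= ver Psi p)%MS -> ip (gM p) y u = 0,
  forall u, (u <= ver Psi p)%MS -> ip (gM p) y (u *m phi p) = 0 & ip (gM p) y (zeta p) = 0].

Lemma transverse_hor p y : transverse p y -> (y <= hor gM Psi p)%MS.
Proof. by case=> H _ _; apply/horP. Qed.

Lemma transverse_phi p y : transverse p y -> transverse p (y *m phi p).
Proof.
move=> [h1 h2 h3]; split=> [u uv|u uv|]; last exact: phi_orth_reeb.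
  by rewrite phi_skew h2// oppr0.
by rewrite phi_iso h3 mul0r subr0 h1.
Qed.

Lemma beta_transverse Z p : GH Z -> transverse p (beta phi gM Psi D1 Z p).
Proof.
move=> [sZ hZ]; rewrite betaE// /tapp; split=> [u uv|u uv|].
- exact: (horP _ _ _ _ (hproj_hor _ _ _ _)).
- rewrite metric_sym ip_hproj//; last exact: phi_ver_hor.
  by rewrite phi_iso (ver_orth_reeb uv) mul0r subr0 metric_sym; exact: (horP _ _ _ _ (hZ p)).
- by rewrite metric_sym ip_hproj//; [rewrite metric_sym phi_orth_reeb|case: reeb_hor].
Qed.

Lemma beta_smooth Z : GH Z -> smooth_vfield (beta phi gM Psi D1 Z).
Proof.
by move=> [sZ hZ]; rewrite betaE//; have [] := Gamma_hproj rgM hcs (phi_field_smooth sZ).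
Qed.

(** Z = - phi Y has phi Z = Y, so that alpha Z = 0 and beta Z = Y. *)
Lemma transverse_beta Y : smooth_vfield Y -> (forall p, transverse p (Y p)) ->
  exists2 Z, GH Z & beta phi gM Psi D1 Z = Y.
Proof.
move=> sY tY; exists (fun q => -1 *: ph Y q).
  split=> [|p]; first by apply: vfieldZc; exact: phi_field_smooth.
  by rewrite scaleN1r eqmx_opp; apply: transverse_hor; exact: transverse_phi.
rewrite betaE; last first.
  by move=> p; rewrite scaleN1r eqmx_opp; apply: transverse_hor; exact: transverse_phi.
apply/funext => p; rewrite /tapp -scalemxAl phi_sqr.
case: (tY p) => _ _ ->; rewrite scale0r addr0 scaleN1r opprK hproj_id//.
exact: transverse_hor.
Qed.

(** [conformal_ver] on the pair (zeta, zeta): as zeta has unit length and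
    nabla_zeta zeta = - phi zeta = 0, the right side is zero. *)
Lemma dilation_ver W p : GV W -> dfun (fun q => lam q ^+ 2) p (W p) = 0.
Proof.
move=> GW; have [sW vW] := GW.
have := conformal_ver rgM rgN lcM lcN pD hcs p reeb_hor reeb_hor GW.
rewrite reeb_unit mulr1 => ->.
have : ip (gM p) (nab zeta W p) (zeta p) = 0.
  rewrite (nab_metric0 lcM p sz sW sz (fun q => ver_orth_reeb (vW q))).
  by rewrite nab_reeb// phi_reeb oppr0 ip0r oppr0.
by move=> ->; rewrite addr0 mulr0.
Qed.

(** The flow of zeta moves the fibres in the direction of phi. This is
    [conformal_ver] on the pair (zeta, Y) with Y horizontal: the dilation being
    constant along the fibres, g(nabla_zeta W, Y) = - g(nabla_Y W, zeta), which
    is g(phi W, Y), and nabla_W zeta = - phi W accounts for the other half. *)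
Lemma lie_reeb_ver W : GV W -> exists W', [/\ GV W',
  br zeta W = (fun q => 2 *: ph W q + W' q)
  & br zeta (ph W) = (fun q => (-2) *: W q + ph W' q)].
Proof.
move=> GW; have [sW vW] := GW.
pose W' q := br zeta W q - 2 *: ph W q.
have W'E : br zeta W = (fun q => 2 *: ph W q + W' q).
  by apply/funext => q; rewrite /W' addrC subrK.
exists W'; split=> //; last first.
  apply/funext => q; rewrite lie_reeb_phi// W'E mulmxDl -scalemxAl phi_sqr.
  by rewrite (ver_orth_reeb (vW q)) scale0r addr0 scalerN scaleNr.
split=> [|p]; first exact: (vfieldB (lie_smooth lcM sz sW) (vfieldZc 2 (phi_field_smooth sW))).
apply: (verP rgM) => u uh; have [Y [sY hY] Yp] := extend_hor rgM hcs uh.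
have := conformal_ver rgM rgN lcM lcN pD hcs p reeb_hor (conj sY hY) GW.
rewrite dilation_ver// mul0r => /esym /eqP.
rewrite mulf_eq0 oppr_eq0 expf_eq0 /= (gt_eqF (dil_gt0 hcs p)) /= => /eqP.
have -> : ip (gM p) (nab Y W p) (zeta p) = - ip (gM p) (W p *m phi p) (Y p).
  rewrite (nab_metric0 lcM p sY sW sz (fun q => ver_orth_reeb (vW q))).
  by rewrite nab_reeb// ipNr phi_skew !opprK.
rewrite -Yp /W' lie_reeb// !ipE => /subr0_eq ->.
by move: (ip _ _ _) => c; lra.
Qed.

(** The flow of zeta preserves the span of the fibre and its image under phi, as
    well as zeta, so it preserves the orthogonal complement of all of these. *)
Lemma lie_reeb_transverse Y p : smooth_vfield Y -> (forall q, transverse q (Y q)) ->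
  transverse p (br zeta Y p).
Proof.
move=> sY tY.
have K0 A : smooth_vfield A -> (forall q, ip (gM q) (Y q) (A q) = 0) ->
    ip (gM p) (br zeta Y p) (A p) = - ip (gM p) (Y p) (br zeta A p).
  exact: (killing_metric0 lcM sz reeb_killing).
have [h1 h2 h3] := tY p.
have hV V : GV V -> ip (gM p) (Y p) (V p) = 0 /\ ip (gM p) (Y p) (V p *m phi p) = 0.
  by move=> [_ vV]; split; [exact: h1 (vV p)|exact: h2 (vV p)].
split=> [u uv|u uv|].
- have [V GVV <-] := extend_ver rgM hcs uv; have [sV vV] := GVV.
  rewrite (K0 _ sV (fun q => let: And3 H _ _ := tY q in H _ (vV q))).
  have [V' [GV' -> _]] := lie_reeb_ver GVV.
  by rewrite !ipE (hV _ GVV).2 (hV _ GV').1 mulr0 addr0 oppr0.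
- have [V GVV <-] := extend_ver rgM hcs uv; have [sV vV] := GVV.
  apply: etrans (K0 _ (phi_field_smooth sV) (fun q => let: And3 _ H _ := tY q in H _ (vV q))) _.
  have [V' [GV' _ ->]] := lie_reeb_ver GVV.
  by rewrite !ipE (hV _ GVV).1 (hV _ GV').2 mulr0 addr0 oppr0.
- rewrite (K0 _ sz (fun q => let: And3 _ _ H := tY q in H)).
  by rewrite lie_reeb_reeb ip0r oppr0.
Qed.

(** Conditions (a) and (b) of the introduction. *)
Definition normal_part := forall W V xi p, GV W -> GV V -> GV xi ->
  ip (gM p) (xi p *m phi p) (nab W V p) = 0.

Definition transverse_part := forall W xi Y p, GV W -> GV xi -> smooth_vfield Y ->
  (forall q, transverse q (Y q)) -> ip (gM p) (nab (ph xi) W p) (Y p) = 0.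

(** By the Sasakian identity nabla_X (phi W) and phi (nabla_X W) differ by a
    multiple of zeta. *)
Lemma nab_phi_transverse X W Y p : smooth_vfield X -> GV W -> transverse p (Y p) ->
  ip (gM p) (nab X (ph W) p) (Y p) = - ip (gM p) (nab X W p) (Y p *m phi p).
Proof.
move=> sX [sW vW] [h1 h2 h3]; rewrite nab_phi_field// ver_orth_reeb// scale0r subr0.
by rewrite !ipE phi_skew (metric_sym _ (zeta p)) h3 mulr0 addr0.
Qed.

(** Pair L_zeta (nabla_xi W) = nabla_(L_zeta xi) W + nabla_xi (L_zeta W) with Y.
    The left side is 2 phi (nabla_xi W) modulo vertical vectors, hence
    orthogonal to Y. On the right all terms but 2 nabla_(phi xi) W are
    orthogonal to Y. *)
Lemma geodesic_parts : totally_geodesic_foliation nab (ver Psi) ->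
  normal_part /\ transverse_part.
Proof.
move=> tg; split=> [W V xi p GW GVV Gxi|W xi Y p GW Gxi sY tY].
  have [_ v] := tg W V GW GVV; have [_ vx] := Gxi.
  exact: (horP _ _ _ _ (phi_ver_hor (vx p))).
have [sW vW] := GW; have [sx vx] := Gxi.
have GA := tg xi W Gxi GW; have [sA vA] := GA.
have [W' [GW' EW _]] := lie_reeb_ver GW; have [sW' _] := GW'.
have [xi' [Gxi' Exi _]] := lie_reeb_ver Gxi; have [sx' _] := Gxi'.
have [A' [GA' EA _]] := lie_reeb_ver GA.
have [h1 h2 h3] := tY p.
have := killing_nab rgM lcM sz reeb_killing p sx sW.
rewrite EA EW Exi.
have s2W := vfieldZc 2 (phi_field_smooth sW); have s2x := vfieldZc 2 (phi_field_smooth sx).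
rewrite (nabDl lcM p s2x sx' sW) (nabDr lcM p sx s2W sW').
rewrite (nabZcl lcM 2 p (phi_field_smooth sx) sW) (nabZcr lcM 2 p sx (phi_field_smooth sW)).
move=> /(congr1 (fun v => ip (gM p) v (Y p))); rewrite !ipE.
have ver0 A : (A <= ver Psi p)%MS -> ip (gM p) A (Y p) = 0 by move=> vA'; rewrite metric_sym h1.
rewrite (ver0 _ (GA'.2 p)) (ver0 _ ((tg _ _ Gxi' GW).2 p)).
rewrite (ver0 _ ((tg _ _ Gxi GW').2 p)).
rewrite (nab_phi_transverse sx GW (tY p)).
have [h1' _ _] := transverse_phi (tY p).
rewrite (metric_sym _ (nab xi W p)) (h1' _ (vA p)).
rewrite [ip _ (ph _ p) _]metric_sym (h2 _ (vA p)).
by move: (ip _ _ _) => c; lra.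
Qed.

(** Apply L_zeta to g(nabla_(phi xi) W, Y) = 0. As L_zeta Y is again transverse,
    L_zeta (nabla_(phi xi) W) is orthogonal to Y. In its expansion
    L_zeta (phi xi) = - 2 xi + phi xi', and the other terms are orthogonal to Y
    by assumption, so - 2 nabla_xi W is orthogonal to Y. *)
Lemma parts_transverse W xi Y p : transverse_part -> GV W -> GV xi -> smooth_vfield Y ->
  (forall q, transverse q (Y q)) -> ip (gM p) (nab xi W p) (Y p) = 0.
Proof.
move=> C GW Gxi sY tY.
have [sW vW] := GW; have [sx vx] := Gxi.
have [W' [GW' EW _]] := lie_reeb_ver GW; have [sW' _] := GW'.
have [xi' [Gxi' _ Exi]] := lie_reeb_ver Gxi; have [sx' _] := Gxi'.
have sA := nab_smooth lcM (phi_field_smooth sx) sW.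
have := killing_metric0 lcM sz reeb_killing p sA sY (fun q => C _ _ _ q GW Gxi sY tY).
rewrite (C _ _ _ p GW Gxi (lie_smooth lcM sz sY) (fun q => lie_reeb_transverse q sY tY)) oppr0.
rewrite (killing_nab rgM lcM sz reeb_killing p (phi_field_smooth sx) sW).
rewrite Exi EW.
have s2W := vfieldZc 2 (phi_field_smooth sW); have s2x := vfieldZc (-2) sx.
rewrite (nabDl lcM p s2x (phi_field_smooth sx') sW) (nabDr lcM p (phi_field_smooth sx) s2W sW').
rewrite (nabZcl lcM (-2) p sx sW) (nabZcr lcM 2 p (phi_field_smooth sx) (phi_field_smooth sW)).
rewrite !ipE (C _ _ _ p GW Gxi' sY tY) (C _ _ _ p GW' Gxi sY tY).
rewrite (nab_phi_transverse (phi_field_smooth sx) GW (tY p)).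
rewrite (C _ _ _ p GW Gxi (phi_field_smooth sY) (fun q => transverse_phi (tY q))).
by move: (ip _ _ _) => c; lra.
Qed.

(** Every horizontal Z is a combination of phi (alpha Z), phi (beta Z) and zeta;
    the three components of nabla_xi W are handled by [normal_part], by
    [parts_transverse] and by g(W, phi xi) = 0. *)
Lemma parts_geodesic : normal_part -> transverse_part ->
  totally_geodesic_foliation nab (ver Psi).
Proof.
move=> T C xi W Gxi GW; have [sW vW] := GW; have [sx vx] := Gxi.
split=> [|p]; first exact: (nab_smooth lcM).
apply: (verP rgM) => u uh; have [Z GZ Zp] := extend_hor rgM hcs uh.
have [sZ hZ] := GZ.
pose a := alpha phi gM Psi D1 Z; pose b := beta phi gM Psi D1 Z.
have Ga : GV a by exact: alpha_ver.
have tb q : transverse q (b q) by exact: beta_transverse.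
have E : Z p = - (a p *m phi p) - b p *m phi p + ip (gM p) (Z p) (zeta p) *: zeta p.
  have <- : - (Z p *m phi p *m phi p) = - (a p *m phi p) - b p *m phi p.
    rewrite -opprD -mulmxDl /a /b alphaE betaE// /tapp hprojE// addrC subrK //.
  by rewrite phi_sqr opprD opprK subrK.
rewrite -Zp E !ipE.
rewrite (metric_sym _ (nab xi W p) (a p *m phi p)) (T _ _ _ _ Gxi GW Ga).
rewrite (parts_transverse p C GW Gxi (phi_field_smooth (beta_smooth GZ)) (fun q => transverse_phi (tb q))).
have -> : ip (gM p) (nab xi W p) (zeta p) = 0.
  rewrite (nab_metric0 lcM p sx sW sz (fun q => ver_orth_reeb (vW q))).
  by rewrite nab_reeb// ipNr opprK metric_sym phi_ver_orth.
by rewrite !oppr0 mulr0 !addr0.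
Qed.

(** On the left, [conformal_sff] leaves g(nabla_(phi xi) (phi W), phi beta Z) and
    a gradient term that cancels the one on the right; phi is an isometry on
    vectors orthogonal to zeta. On the right, T_W (alpha Z) may be replaced by
    nabla_W (alpha Z), as phi xi is horizontal, and eta (beta Z) = 0. *)
Lemma formula_core W xi Z p : GV W -> GV xi -> GH Z ->
  let bZ := beta phi gM Psi D1 Z in
  let phibZ := tapp phi bZ in
  (lam p ^+ 2)^-1 *
    ip (gN (Psi p)) (D (ph xi) (push (ph W)) p) (push phibZ p)
  = ip (gM p) (ph xi p) (oneill_T gM nab Psi W (alpha phi gM Psi D1 Z) p)
    - ip (gM p) (W p) (xi p) *
        ip (gM p) (tapp (hproj gM Psi) (grad gM (fun q => ln (lam q))) p) (phibZ p)
    + ev (eta p) (bZ p) * ip (gM p) (W p) (xi p)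
  <-> ip (gM p) (nab (ph xi) W p) (bZ p)
      = ip (gM p) (xi p *m phi p) (nab W (alpha phi gM Psi D1 Z) p).
Proof.
move=> GW Gxi GZ bZ phibZ; have [sW vW] := GW; have [sx vx] := Gxi; have [sZ hZ] := GZ.
have tb q : transverse q (bZ q) by exact: beta_transverse.
have sb : smooth_vfield bZ by exact: beta_smooth.
have tpb q : transverse q (phibZ q) := transverse_phi (tb q).
have Ga : GV (alpha phi gM Psi D1 Z) by exact: alpha_ver.
have GphX A : GV A -> GH (ph A).
  by move=> [sA vA]; split=> [|q]; [exact: phi_field_smooth|exact: phi_ver_hor].
have Gpb : GH phibZ.
  by split=> [|q]; [exact: phi_field_smooth|exact: transverse_hor].
have -> : ev (eta p) (bZ p) = 0 by rewrite etaE; case: (tb p).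
have T_eq : ip (gM p) (ph xi p) (oneill_T gM nab Psi W (alpha phi gM Psi D1 Z) p)
    = ip (gM p) (xi p *m phi p) (nab W (alpha phi gM Psi D1 Z) p).
  have vid A : GV A -> tapp (vproj gM Psi) A = A.
    by move=> [_ vA]; apply/funext => q; rewrite /tapp vproj_id.
  have h0 A : GV A -> tapp (hproj gM Psi) A = fun=> 0.
    by move=> [_ vA]; apply/funext => q; rewrite /tapp hproj_ver0.
  set a := alpha phi gM Psi D1 Z in Ga *.
  have -> : oneill_T gM nab Psi W a p
      = nab (tapp (vproj gM Psi) W) (tapp (vproj gM Psi) a) p *m hproj gM Psi p
        + nab (tapp (vproj gM Psi) W) (tapp (hproj gM Psi) a) p *m vproj gM Psi p by [].
  rewrite (vid _ GW) (vid _ Ga) (h0 _ Ga) (nab0r lcM p sW) mul0mx addr0.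
  exact: (ip_hproj _ _ (phi_ver_hor (vx p))).
rewrite T_eq.
have grad_eq : ip (gM p) (tapp (hproj gM Psi) (grad gM (fun q => ln (lam q))) p) (phibZ p)
    = dfun (fun q => lam q ^+ 2) p (phibZ p) / (2 * lam p ^+ 2).
  rewrite metric_sym /tapp ip_hproj//; last exact: transverse_hor.
  by rewrite metric_sym (grad_ip rgM) (dfun_ln_dil hcs).
rewrite grad_eq mul0r addr0.
have := conformal_sff rgM rgN lcM lcN pD hcs p (GphX _ Gxi) (GphX _ GW) Gpb.
have [h1 h2 h3] := tpb p.
have -> : ip (gM p) (ph W p) (phibZ p) = 0 by rewrite metric_sym; exact: h2.
have -> : ip (gM p) (ph xi p) (phibZ p) = 0 by rewrite metric_sym; exact: h2.
have -> : ip (gM p) (ph xi p) (ph W p) = ip (gM p) (W p) (xi p).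
  by rewrite phi_iso ver_orth_reeb// mul0r subr0 metric_sym.
have pb : phibZ p *m phi p = - bZ p.
  by have [_ _ b0] := tb p; rewrite /phibZ /tapp phi_sqr b0 scale0r addr0.
rewrite (nab_phi_transverse (phi_field_smooth sx) GW (tpb p)) pb ipNr opprK.
move: (ip _ (nab (ph xi) W p) _) (ip _ (xi p *m phi p) _) (ip _ (W p) (xi p)) => a b c.
move: (ip _ _ _) (dfun (fun q => lam q ^+ 2) p (phibZ p)) => x d.
have l0 : lam p ^+ 2 != 0 by rewrite expf_neq0// gt_eqF// (dil_gt0 hcs).
rewrite !mulr0 add0r sub0r => H.
have -> : (lam p ^+ 2)^-1 * x = a - c * (d / (2 * lam p ^+ 2)).
  have -> : x = lam p ^+ 2 * a - d * c / 2.
    move: H; move: (d * c) (lam p ^+ 2 * a) => k l; lra.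
  by move: l0; move: (lam p ^+ 2) => l l0; field.
by split=> [/addIr|->].
Qed.

Lemma formula_parts :
  (forall W xi Z p, GV W -> GV xi -> GH Z ->
   ip (gM p) (nab (ph xi) W p) (beta phi gM Psi D1 Z p)
      = ip (gM p) (xi p *m phi p) (nab W (alpha phi gM Psi D1 Z) p))
  <-> normal_part /\ transverse_part.
Proof.
split=> [F|[T C] W xi Z p GW Gxi GZ]; last first.
  rewrite (C _ _ _ p GW Gxi (beta_smooth GZ) (fun q => beta_transverse q GZ)).
  by rewrite (T _ _ _ p GW (alpha_ver GZ.1) Gxi).
have T : normal_part.
  move=> W V xi p GW GVV Gxi; have [sV vV] := GVV.
  have GZ : GH (ph V) by split=> [|q]; [exact: phi_field_smooth|exact: phi_ver_hor].
  have ppV q : ph (ph V) q = - V q by rewrite /tapp phi_sqr ver_orth_reeb// scale0r addr0.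
  have nV q : (- V q <= ver Psi q)%MS by rewrite eqmx_opp.
  have := F W xi (ph V) p GW Gxi GZ.
  rewrite betaE; last by case: GZ.
  have -> : alpha phi gM Psi D1 (ph V) = fun q => -1 *: V q.
    rewrite alphaE; apply/funext => q.
    have E : ph (ph V) q *m vproj gM Psi q = -1 *: V q by rewrite ppV vproj_id// scaleN1r.
    exact: E.
  have -> : tapp (hproj gM Psi) (ph (ph V)) p = 0.
    have E : ph (ph V) p *m hproj gM Psi p = 0 by rewrite ppV hproj_ver0.
    exact: E.
  rewrite ip0r (nabZcr lcM (-1) p GW.1 sV).
  by rewrite ipZr mulN1r => /esym /eqP; rewrite oppr_eq0 => /eqP.
split=> // W xi Y p GW Gxi sY tY.
have [Z GZ <-] := transverse_beta sY tY.
by rewrite F// (T _ _ _ p GW (alpha_ver GZ.1) Gxi).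
Qed.

Lemma totally_geodesic_D2 :
  totally_geodesic_foliation nab (D2 gM Psi D1) <->
  totally_geodesic_foliation nab (ver Psi).
Proof. by split=> tg X Y /GammaD2 GX /GammaD2 GY; apply/GammaD2; exact: tg. Qed.

(** As D1 = 0, this second fundamental form is evaluated at phi U = 0. *)
Lemma sff_D1 W U : GV W -> Gamma D1 U ->
  Gamma_along Psi (fun p => mu phi gM Psi D1 p *m tmap Psi p)
    (second_fundamental_form nab D Psi W (ph U)).
Proof.
move=> [sW _] [_ dU].
have U0 : ph U = fun=> 0.
  by apply/funext => p; rewrite /tapp (D1_eq0 (dU p)) mul0mx.
have -> : second_fundamental_form nab D Psi W (ph U) = fun=> 0.
  apply/funext => p; rewrite /second_fundamental_form U0 (nab0r lcM)// mul0mx subr0.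
  have -> : push (fun=> 0) = fun=> 0 by apply/funext => q; rewrite /tapp mul0mx.
  exact: (push_conn0 pD hcs).
split=> [|p]; last exact: sub0mx.
exact: (section_0 (subm_smooth hcs) openT).
Qed.

Lemma vertical_geodesic_iff :
  totally_geodesic_foliation nab (ver Psi) <->
  (forall W xi Z p, GV W -> GV xi -> GH Z ->
   ip (gM p) (nab (ph xi) W p) (beta phi gM Psi D1 Z p)
      = ip (gM p) (xi p *m phi p) (nab W (alpha phi gM Psi D1 Z) p)).
Proof.
split=> [/geodesic_parts/formula_parts//|/formula_parts[T C]].
exact: parts_geodesic.
Qed.

End SasakianSubmersion.

Theorem theorem3p17 (R : realType) (m n : nat)
    (M : manifold R m) (N : manifold R n)
    (phi : M -> 'M[R]_m) (zeta : M -> 'rV[R]_m) (eta : M -> 'cV[R]_m)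
    (gM : M -> 'M[R]_m) (gN : N -> 'M[R]_n)
    (nablaM : (M -> 'rV[R]_m) -> (M -> 'rV[R]_m) -> M -> 'rV[R]_m)
    (nablaN : (N -> 'rV[R]_n) -> (N -> 'rV[R]_n) -> N -> 'rV[R]_n)
    (nablaPsi : (M -> 'rV[R]_m) -> (M -> 'rV[R]_n) -> M -> 'rV[R]_n)
    (Psi : M -> N) (lambda : M -> R) (D1 : M -> 'M[R]_m) :
  levi_civita gM nablaM ->
  sasakian phi zeta eta gM nablaM ->
  riemannian_metric gN ->
  levi_civita gN nablaN ->
  pullback_connection Psi nablaN nablaPsi ->
  semi_invariant_conformal_submersion phi zeta gM gN Psi lambda D1 ->
  totally_geodesic_foliation nablaM (D2 gM Psi D1) <->
  (forall W xi U Z : M -> 'rV[R]_m,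
    Gamma (D2 gM Psi D1) W -> Gamma (D2 gM Psi D1) xi ->
    Gamma D1 U -> Gamma (hor gM Psi) Z ->
    Gamma_along Psi (fun p => mu phi gM Psi D1 p *m tmap Psi p)
      (second_fundamental_form nablaM nablaPsi Psi W (tapp phi U)) /\
    (forall p : M,
      let bZ := beta phi gM Psi D1 Z in
      let phibZ := tapp phi bZ in
      (lambda p ^+ 2)^-1 *
        ip (gN (Psi p))
          (nablaPsi (tapp phi xi) (tapp (tmap Psi) (tapp phi W)) p)
          (tapp (tmap Psi) phibZ p)
      = ip (gM p) (tapp phi xi p)
          (oneill_T gM nablaM Psi W (alpha phi gM Psi D1 Z) p)
        - ip (gM p) (W p) (xi p) *
            ip (gM p)
              (tapp (hproj gM Psi) (grad gM (fun q => ln (lambda q))) p)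
              (phibZ p)
        + ev (eta p) (bZ p) * ip (gM p) (W p) (xi p))).
Proof.
move=> lcM sas rgN lcN pD sub.
have toV X : Gamma (D2 gM Psi D1) X <-> Gamma (ver Psi) X.
  exact: (GammaD2 lcM sas lcN pD sub).
split=> [tg W xi U Z /toV GW /toV Gxi GU GZ|F].
  have V := (totally_geodesic_D2 lcM sas lcN pD sub).1 tg.
  have core := (vertical_geodesic_iff lcM sas rgN lcN pD sub).1 V.
  split=> [|p]; first exact: (sff_D1 lcM sas lcN pD sub).
  by apply/(formula_core lcM sas rgN lcN pD sub p GW Gxi GZ); exact: core.
apply/(totally_geodesic_D2 lcM sas lcN pD sub).
apply/(vertical_geodesic_iff lcM sas rgN lcN pD sub) => W xi Z p GW Gxi GZ.
(* The zero field is a section of D1, so F applies. *)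
have G0 : Gamma D1 (fun=> 0).
  by split=> [|q]; [exact: (section_0 (smooth_idfun M) openT)|exact: sub0mx].
have [_ H] := F W xi (fun=> 0) Z ((toV W).2 GW) ((toV xi).2 Gxi) G0 GZ.
by apply/(formula_core lcM sas rgN lcN pD sub p GW Gxi GZ); exact: H.
Qed.
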